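(* For all $t_f>0$ there exist positive constants $C,c$ such that for every function $f\in\mathcal{C}^2(SU(2))$ and every $t>t_f$: $$\|\nabla_{\mathcal{H}}P_tf(g)\|_{\mathcal{H}}\le 2\|f\|_\infty\, C e^{-ct}\quad\text{for a.e. } g\in SU(2).$$ In particular, if $f\in\mathcal{C}^2(SU(2))$ is harmonic on $SU(2)$, then it is constant.
   Context: On $SU(2)$ take $X=\frac12\begin{pmatrix}0&1\\-1&0\end{pmatrix}$, $Y=\frac12\begin{pmatrix}0&i\\i&0\end{pmatrix}$ in the Lie algebra, with left-invariant vector fields $\bar X,\bar Y$, $\bar A_g=\frac{\partial}{\partial\epsilon}\big|_{\epsilon=0} g\exp(\epsilon A)$. The subLaplacian is $L=\frac12(\bar X^2+\bar Y^2)$; $(P_t)_t$ is the associated heat semigroup, $P_tf(g)=\mathbb{E}[f(\mathbb{B}_t)]$ where $(\mathbb{B}_t)_t$ is the Brownian motion on $SU(2)$ started at $g$, i.e. the continuous Markov process with infinitesimal generator $L$. The norm of the horizontal gradient is $\|\nabla_{\mathcal{H}}f(g)\|_{\mathcal{H}}=\sqrt{(\bar Xf)^2(g)+(\bar Yf)^2(g)}$. A function $f$ is harmonic if $Lf=0$. ''A.e.'' refers to the Haar measure. *)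

(* Defs.v *)
From HB Require Import structures.
From mathcomp Require Import all_boot all_order all_algebra.
From mathcomp Require Import spectral complex.
From mathcomp Require Import all_classical all_reals all_analysis.
From mathcomp Require Import measurable_realfun ring.

Set Implicit Arguments.
Unset Strict Implicit.
Unset Printing Implicit Defensive.

Import Order.TTheory GRing.Theory Num.Theory.
Import numFieldNormedType.Exports.

Local Open Scope classical_set_scope.
Local Open Scope ring_scope.

(* A bare [R[i]] has no inferred topology; this packing gives it the one of a
   numFieldType. *)
Definition cplx (R : realType) : numClosedFieldType := R[i]%C.

Section SU2.
Variable R : realType.
Local Notation C := (cplx R).
Local Notation ofR := (fun x : R => (x%:C)%C : C).
Local Notation adj A := (map_mx Num.conj A^T).

Definition special_unitary : {pred 'M[C]_2} :=
  [pred A | (A \is unitarymx) && (\det A == 1)].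

Record SU2 := MkSU2 { SU2val :> 'M[C]_2; SU2valP : SU2val \in special_unitary }.

HB.instance Definition _ := [isSub for SU2val].
HB.instance Definition _ := [Choice of SU2 by <:].

Lemma special_unitary1 : 1%:M \in special_unitary.
Proof. by rewrite inE det1 eqxx andbT; apply/unitarymxP; rewrite mul1mx trmx1 map_mx1. Qed.

Lemma special_unitaryM A B : A \in special_unitary -> B \in special_unitary ->
  A *m B \in special_unitary.
Proof.
rewrite !inE => /andP[uA /eqP dA] /andP[uB /eqP dB].
by rewrite mul_unitarymx//= det_mulmx dA dB mulr1.
Qed.

Lemma special_unitaryV A : A \in special_unitary -> adj A \in special_unitary.
Proof.
rewrite !inE => /andP[uA /eqP dA].
by rewrite trmxC_unitary uA/= det_map_mx det_tr dA rmorph1.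
Qed.

Definition SU2_one := MkSU2 special_unitary1.
Definition SU2_mul (g h : SU2) := MkSU2 (special_unitaryM (SU2valP g) (SU2valP h)).
Definition SU2_inv (g : SU2) := MkSU2 (special_unitaryV (SU2valP g)).

Lemma SU2_mulA : associative SU2_mul.
Proof. by move=> x y z; apply: val_inj => /=; rewrite mulmxA. Qed.
Lemma SU2_mul1g : left_id SU2_one SU2_mul.
Proof. by move=> x; apply: val_inj => /=; rewrite mul1mx. Qed.
Lemma SU2_mulg1 : right_id SU2_one SU2_mul.
Proof. by move=> x; apply: val_inj => /=; rewrite mulmx1. Qed.
Lemma SU2_mulgV : right_inverse SU2_one SU2_inv SU2_mul.
Proof. by case=> A pA; apply: val_inj; have := pA; rewrite inE => /andP[/unitarymxP]. Qed.
Lemma SU2_mulVg : left_inverse SU2_one SU2_inv SU2_mul.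
Proof. by move=> g; apply: val_inj; apply: mulmx1C; exact: (congr1 SU2val (SU2_mulgV g)). Qed.

HB.instance Definition _ :=
  isGroup.Build SU2 SU2_mulA SU2_mul1g SU2_mulg1 SU2_mulVg SU2_mulgV.

HB.instance Definition _ := isPointed.Build SU2 SU2_one.

HB.instance Definition _ := Topological.copy SU2 (initial_topology SU2val).

HB.instance Definition _ :=
  Measurable.copy SU2 (g_sigma_algebraType (@open SU2)).

Definition skew_hermitian0 : {pred 'M[C]_2} :=
  [pred A | (adj A == - A) && (\tr A == 0)].

Record su2 := MkLie { su2val :> 'M[C]_2; su2valP : su2val \in skew_hermitian0 }.

Definition expmx (A : 'M[C]_2) : 'M[C]_2 :=
  lim (series (fun k => (k`!%:R^-1 : C) *: A ^+ k) @ \oo).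

Lemma sum_ord2 (F : 'I_2 -> C) : \sum_i F i = F 0 + F 1.
Proof. by rewrite big_ord_recr big_ord1 /=; congr (F _ + F _); apply: val_inj. Qed.

Lemma ord2P (k : 'I_2) : k = 0 \/ k = 1.
Proof. by case: k => [[|[|//]] ?]; [left|right]; apply: val_inj. Qed.

Lemma det_mx22 (A : 'M[C]_2) : \det A = A 0 0 * A 1 1 - A 0 1 * A 1 0.
Proof.
rewrite (expand_det_row _ 0) sum_ord2 /cofactor !det_mx11 !mxE /=.
have -> : lift 0 0 = 1 :> 'I_2 by apply: val_inj.
have -> : lift 1 0 = 0 :> 'I_2 by apply: val_inj.
by rewrite expr0 expr1; ring.
Qed.

Lemma trace0_sqr (A : 'M[C]_2) : \tr A = 0 -> A *m A = (- \det A)%:M.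
Proof.
rewrite /mxtrace sum_ord2 => /eqP; rewrite addr_eq0 => /eqP A00.
apply/matrixP => i j; rewrite !mxE sum_ord2 det_mx22.
by case: (ord2P i) => ->; case: (ord2P j) => ->; rewrite /= ?mulr1n ?mulr0n ?A00; ring.
Qed.

Lemma normsq_real (z : C) : exists2 r : R, z * Num.conj z = ofR (r ^+ 2) & (r = 0 -> z = 0).
Proof.
exists (complex.Re `|z|).
  rewrite -normCK -[in LHS](@RRe_real _ `|z|) ?normr_real//.
  by rewrite -rmorphXn.
by move=> z0; apply/eqP; rewrite -normr_eq0 -(@RRe_real _ `|z|) ?normr_real// z0.
Qed.

Lemma skew_hermitian0_det (A : 'M[C]_2) : A \in skew_hermitian0 ->
  exists2 r : R, \det A = ofR (r ^+ 2) & (r = 0 -> A = 0).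
Proof.
rewrite inE => /andP[/eqP/matrixP hA /eqP].
rewrite /mxtrace sum_ord2 => /eqP; rewrite addr_eq0 => /eqP A00.
have [r1 e1 z1] := normsq_real (A 0 0); have [r2 e2 z2] := normsq_real (A 0 1).
have := hA 0 0; have := hA 1 0; rewrite !mxE => h10 h00.
have dA : \det A = ofR (r1 ^+ 2 + r2 ^+ 2).
  by rewrite det_mx22 rmorphD /= -e1 -e2 h10 h00 A00; ring.
exists (Num.sqrt (r1 ^+ 2 + r2 ^+ 2)).
  by rewrite dA sqr_sqrtr// addr_ge0 ?sqr_ge0.
move/eqP; rewrite sqrtr_eq0 => le0.
have : r1 ^+ 2 + r2 ^+ 2 == 0 by rewrite eq_le le0 addr_ge0 ?sqr_ge0.
rewrite paddr_eq0 ?sqr_ge0// !expf_eq0 /= => /andP[/eqP/z1 E1 /eqP/z2 E2].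
have A11 : A 1 1 = 0 by apply/eqP; rewrite -oppr_eq0 -A00 E1.
have A10 : A 1 0 = 0 by apply/eqP; rewrite -oppr_eq0 -h10 E2 rmorph0.
apply/matrixP => i j; rewrite mxE.
by case: (ord2P i) => ->; case: (ord2P j) => ->.
Qed.

Lemma ofR_continuous : continuous ofR.
Proof.
move=> x; apply/cvgrPdist_lt => e e0.
have eE : e = ofR (complex.Re e) by rewrite RRe_real// gtr0_real.
have : 0 < complex.Re e by move: e0; rewrite eE ltcR.
move=> re0; near=> y.
rewrite -rmorphB normc_def /= expr0n addr0 sqrtr_sqr eE ltcR.
near: y; exact: (@cvgr_dist_lt _ _ _ _ _ id x).
Unshelve. all: by end_near. Qed.

Lemma expmx_su2 (A : 'M[C]_2) (r : R) : \tr A = 0 -> \det A = ofR (r ^+ 2) ->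
  (r = 0 -> A = 0) ->
  expmx A = ofR (cos r) *: 1 + ofR (sin r / r) *: A.
Proof.
move=> trA dA A0.
have sqA : A * A = ofR (- r ^+ 2) *: 1.
  rewrite -[LHS]/(A *m A) trace0_sqr// dA -scalemx1.
  by congr (_ *: _); rewrite -rmorphN.
have evA m : A ^+ m.*2 = ofR ((-1) ^+ m * r ^+ m.*2) *: 1.
  rewrite -mul2n exprM expr2 sqA exprZn expr1n mul2n; congr (_ *: _).
  by rewrite -rmorphXn /= -[- r ^+ 2]mulN1r exprMn -exprM mul2n.
have termE k : (k`!%:R^-1 : C) *: A ^+ k =
    ofR (cos_coeff r k) *: 1 + ofR (sin_coeff r k / r) *: A.
  have fE : (k`!%:R^-1 : C) = ofR (k`!%:R^-1) by rewrite fmorphV/= rmorph_nat.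
  rewrite fE /cos_coeff /sin_coeff /=; have [odk|evk] := boolP (odd k).
    rewrite !mul0r mul1r scale0r add0r -[k in A ^+ k]odd_double_half odk add1n.
    rewrite exprS evA -scalerAr mulr1 scalerA -rmorphM /=.
    have [r0|r0] := eqVneq r 0; first by rewrite A0// !scaler0.
    congr (ofR _ *: _); rewrite -[in RHS](odd_double_half k) odk add1n /=.
    have -> : (k./2.*2.+1)`! = k`! by rewrite -[in RHS](odd_double_half k) odk.
    rewrite doubleK exprS; field.
    by rewrite r0/= pnatr_eq0 -lt0n fact_gt0.
  rewrite !mul0r mul1r scale0r addr0 -[k in A ^+ k]odd_double_half (negbTE evk) add0n.
  rewrite evA scalerA -rmorphM /=; congr (ofR _ *: _).
  have -> : r ^+ k = r ^+ k./2.*2 by rewrite -[in LHS](odd_double_half k) (negbTE evk).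
  by rewrite -exprnP; ring.
have serE : series (fun k => (k`!%:R^-1 : C) *: A ^+ k) =
  (fun n => ofR (series (cos_coeff r) n) *: 1 +
            ofR (series (sin_coeff r) n / r) *: A).
  apply/funext => n; rewrite /series /= (eq_bigr _ (fun k _ => termE k)) big_split /=.
  by rewrite -!scaler_suml -!rmorph_sum -mulr_suml.
rewrite /expmx serE; apply: cvg_lim; first exact: norm_hausdorff.
have cosE : series (cos_coeff r) @ \oo --> cos r.
  by rewrite unlock; exact: is_cvg_series_cos_coeff.
have sinE : series (sin_coeff r) @ \oo --> sin r.
  by rewrite unlock; exact: is_cvg_series_sin_coeff.
have cvg_ofR (u : R^nat) (l : R) : u @ \oo --> l ->
    (fun n => ofR (u n)) @ \oo --> ofR l.
  by move=> ul; apply: (cvg_comp u ofR ul); exact: ofR_continuous.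
apply: cvgD; apply: cvgZr_tmp; apply: cvg_ofR => //.
by apply: cvgMr_tmp.
Qed.

Lemma expmx_special_unitary (A : 'M[C]_2) :
  A \in skew_hermitian0 -> expmx A \in special_unitary.
Proof.
move=> sA; have [r dA A0] := skew_hermitian0_det sA.
move: (sA); rewrite inE => /andP[/eqP adjA /eqP trA].
rewrite (expmx_su2 trA dA A0); set c := cos r; set s := sin r / r.
have cs : c ^+ 2 + s ^+ 2 * r ^+ 2 = 1.
  rewrite /s /c -exprMn; have [->|r0] := eqVneq r 0.
    by rewrite cos0 mulr0 expr1n expr0n addr0.
  by rewrite divfK// cos2Dsin2.
have detE : \det (ofR c *: 1 + ofR s *: A) = 1.
  rewrite det_mx22 !mxE /= ?mulr1n ?mulr0n.
  have -> : A 1 1 = - A 0 0.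
    by move/eqP: trA; rewrite /mxtrace sum_ord2 addrC addr_eq0 => /eqP.
  transitivity (ofR (c ^+ 2) + ofR (s ^+ 2) * \det A); last first.
    by rewrite dA -rmorphM -rmorphD /= cs.
  rewrite det_mx22 !rmorphXn /=.
  have -> : A 1 1 = - A 0 0.
    by move/eqP: trA; rewrite /mxtrace sum_ord2 addrC addr_eq0 => /eqP.
  by ring.
clearbody c s; rewrite inE detE eqxx andbT; apply/unitarymxP.
have cR (x : R) : Num.conj (ofR x) = ofR x by apply: conj_Creal; rewrite complex_real.
have -> : adj (ofR c *: 1 + ofR s *: A) = ofR c *: 1 - ofR s *: A.
  rewrite linearD/= !linearZ/= map_mxD !map_mxZ/= !cR adjA trmx1 map_mx1.
  by rewrite scalerN.
have sqA : A * A = (- ofR (r ^+ 2)) *: (1 : 'M[C]_2).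
  by rewrite -[LHS]/(A *m A) trace0_sqr// dA -scalemx1.
rewrite -[LHS]/(_ * _) -[RHS]/1 mulrDl !mulrBr -!scalerAl -!scalerAr !mul1r mulr1.
rewrite sqA !scalerA -[X in _ = X]scale1r -[in RHS](rmorph1 (real_complex R)) -cs.
rewrite [ofR s * ofR c]mulrC addrA subrK -scalerBl; congr (_ *: _).
by rewrite rmorphD /= rmorphM !rmorphXn /=; ring.
Qed.

Lemma skew_hermitian0Z (t : R) (A : 'M[C]_2) :
  A \in skew_hermitian0 -> ofR t *: A \in skew_hermitian0.
Proof.
rewrite !inE => /andP[/eqP hA /eqP tA].
have cR : Num.conj (ofR t) = ofR t by apply: conj_Creal; rewrite complex_real.
by rewrite linearZ/= map_mxZ/= cR hA scalerN eqxx/= mxtraceZ tA mulr0.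
Qed.

Definition su2_exp (A : su2) (t : R) : SU2 :=
  MkSU2 (expmx_special_unitary (skew_hermitian0Z t (su2valP A))).

Definition mx22 (a b c d : C) : 'M[C]_2 :=
  \matrix_(i, j) (if i == 0 then if j == 0 then a else b
                  else if j == 0 then c else d).

Lemma su2X_subproof : 2^-1 *: mx22 0 1 (-1) 0 \in skew_hermitian0.
Proof.
rewrite inE linearZ/= map_mxZ/= mxtraceZ /mxtrace sum_ord2 !mxE/= addr0 mulr0 eqxx andbT.
apply/eqP/matrixP => i j; rewrite !mxE fmorphV/= rmorph_nat.
by case: (ord2P i) => ->; case: (ord2P j) => ->; rewrite /= ?rmorphN ?rmorph0 ?rmorph1; ring.
Qed.

Lemma su2Y_subproof : 2^-1 *: mx22 0 'i 'i 0 \in skew_hermitian0.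
Proof.
rewrite inE linearZ/= map_mxZ/= mxtraceZ /mxtrace sum_ord2 !mxE/= addr0 mulr0 eqxx andbT.
apply/eqP/matrixP => i j; rewrite !mxE fmorphV/= rmorph_nat.
by case: (ord2P i) => ->; case: (ord2P j) => ->; rewrite /= ?conjCi ?rmorph0; ring.
Qed.

Definition su2X : su2 := MkLie su2X_subproof.
Definition su2Y : su2 := MkLie su2Y_subproof.

Definition lderivable (A : su2) (f : SU2 -> R) (g : SU2) : Prop :=
  derivable (fun eps : R => f (g * su2_exp A eps)%g) 0 1.

Definition lderive (A : su2) (f : SU2 -> R) (g : SU2) : R :=
  derive1 (fun eps : R => f (g * su2_exp A eps)%g) 0.

(* [f] is of class C^k.  The left-invariant vector fields contain a global
   frame of the tangent bundle, so regularity is tested on their iterated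
   derivatives. *)
Fixpoint is_Ck (k : nat) (f : SU2 -> R) : Prop :=
  continuous f /\
  match k with
  | 0 => True
  | k'.+1 => forall A : su2,
      (forall g, lderivable A f g) /\ is_Ck k' (lderive A f)
  end.

Definition subLaplacian (f : SU2 -> R) (g : SU2) : R :=
  2^-1 * (lderive su2X (lderive su2X f) g + lderive su2Y (lderive su2Y f) g).

Definition hgrad_norm (f : SU2 -> R) (g : SU2) : R :=
  Num.sqrt (lderive su2X f g ^+ 2 + lderive su2Y f g ^+ 2).

Definition SU2_harmonic (f : SU2 -> R) : Prop := forall g, subLaplacian f g = 0.

Definition sup_norm (f : SU2 -> R) : R := sup (range (fun g => `|f g|)).

(* Left-invariant, nonzero and finite, since the group is compact;
   not assumed to be normalised. *)
Definition is_haar (mu : {measure set SU2 -> \bar R}) : Prop :=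
  (0 < mu setT < +oo)%E /\
  forall (g : SU2) (A : set SU2), measurable A ->
    mu ((fun h => g * h)%g @` A) = mu A.

Section Brownian.
Variables (d : measure_display) (Omega : measurableType d).
(* [Pr g] is the law under which the process [B] starts at [g].  Only the times
   [0 <= t] are relevant.  The last field says that the infinitesimal generator
   of the semigroup, in the space of continuous functions with the sup norm, is
   given by the subLaplacian on the C^2 functions. *)
Variables (Pr : SU2 -> probability Omega R) (B : R -> Omega -> SU2).

Definition heat (t : R) (f : SU2 -> R) (g : SU2) : R :=
  fine 'E_(Pr g)[f \o B t].

Definition past (s : R) : set (set Omega) :=
  <<s [set E | exists u, 0 <= u <= s /\
         exists2 D : set SU2, measurable D & E = B u @^-1` D] >>.

Record is_brownian : Prop := {
  brownian_measurable : forall t : R, 0 <= t -> measurable_fun setT (B t);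
  brownian_start : forall g, {ae Pr g, forall w, B 0 w = g};
  brownian_continuous : forall g,
    {ae Pr g, forall w, {within [set t | 0 <= t], continuous (fun t => B t w)}};
  brownian_kernel : forall (t : R) (D : set SU2), 0 <= t -> measurable D ->
    measurable_fun setT (fun g : SU2 => Pr g (B t @^-1` D));
  brownian_markov : forall (g : SU2) (s t : R) (E : set Omega) (D : set SU2),
    0 <= s -> 0 <= t -> past s E -> measurable D ->
    Pr g (E `&` B (s + t) @^-1` D) =
    (\int[Pr g]_(w in E) Pr (B s w) (B t @^-1` D))%E;
  brownian_generator : forall f, is_Ck 2 f ->
    {uniform, (fun t g => t^-1 * (heat t f g - f g)) @ 0^'+
              --> subLaplacian f}
}.
End Brownian.

End SU2.

(* Main.v *)
Require Import Defs.
From mathcomp Require Import all_boot all_order all_algebra.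
From mathcomp Require Import spectral complex finmap.
From mathcomp Require Import all_classical all_reals all_analysis.
From mathcomp Require Import measurable_realfun ring lra.

Set Implicit Arguments.
Unset Strict Implicit.
Unset Printing Implicit Defensive.

Import Order.TTheory GRing.Theory Num.Theory.
Import numFieldNormedType.Exports.

Local Open Scope classical_set_scope.
Local Open Scope ring_scope.

(** Write L for the subLaplacian and Z = [X, Y], so that [Y, Z] = X, [Z, X] = Y
and Z commutes with L.  The theorem rests on an estimate in the style of
Bernstein: if u solves the heat equation du/dt = L u, then the function
  u^2 + b(t) ((X u)^2 + (Y u)^2) + c(t) (Z u)^2
is a subsolution of the same equation, where, with E = exp (t / 5),
  b = E - 1   and   c = (5 / 4) (E - 1)^2 / E.
Commuting X and Y with L produces the terms 2 X u Y Z u - 2 Y u X Z u; they are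
absorbed by the gradient of Z u, which c supplies, while the antisymmetric part
of the horizontal Hessian is Z u itself and pays for the growth of c
([bernstein_inequality]).  Since b and c vanish at t = 0, the parabolic maximum
principle ([parabolic_max_principle]) bounds the function by the supremum of
u(0)^2, hence (X u)^2 + (Y u)^2 <= sup |u(0)|^2 / (exp (t / 5) - 1): a smoothing
effect for small t and exponential decay for large t in a single inequality
([bernstein_estimate]).

The heat equation is solved explicitly on polynomial functions of the matrix
entries: each of them lies in a finite-dimensional space that is stable under
the left-invariant vector fields ([polyfun_invariant_span]), so the equation
becomes a linear differential system ([heat_flow_exists]).  By Stone-Weierstrass
([polyfun_dense]) these functions are dense in the continuous functions.

For a Brownian motion, the Markov semigroup and the heat flow have the same
generator on polynomial functions; comparing them on n steps of length t / n
shows that they agree ([heat_of_heat_flow]).  A function f is a uniform limit of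
polynomial functions p_n; the estimate applied to p_n - p_m shows that the
horizontal derivatives of P_t p_n are uniformly Cauchy, so P_t f is
differentiable along X and Y and inherits the bound, at every point of the group
([heat_gradient]).

If f is harmonic, the maximum principle keeps the heat flow u started at a
polynomial close to f within the same distance of f for all times
([heat_flow_near_harmonic]).  As the derivatives of u along X, Y and Z tend to
0, f is constant along every one-parameter subgroup, and these cover the group
([su2_exp_surjective]). *)

(** * Uniform approximation by algebras of continuous functions *)

Section ContinuousFunctions.
Variables (K : numFieldType) (T : topologicalType).
Implicit Types f h : T -> K.

Lemma continuous_add f h : continuous f -> continuous h ->
  continuous (fun x => f x + h x).
Proof. by move=> cf ch x; apply: cvgD; [exact: cf|exact: ch]. Qed.

Lemma continuous_mul f h : continuous f -> continuous h ->
  continuous (fun x => f x * h x).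
Proof. by move=> cf ch x; apply: cvgM; [exact: cf|exact: ch]. Qed.

Lemma continuous_cst (a : K) : continuous (fun _ : T => a).
Proof. by move=> x; exact: cvg_cst. Qed.

Lemma continuous_sum (I : finType) (F : I -> T -> K) :
  (forall i, continuous (F i)) -> continuous (fun x => \sum_i F i x).
Proof.
move=> cF; elim: (index_enum I) => [|i s IH].
  by under eq_fun do rewrite big_nil; exact: continuous_cst.
by under eq_fun do rewrite big_cons; exact: continuous_add.
Qed.

Lemma continuous_comp_fun (U V : topologicalType) (f : T -> U) (k : U -> V) :
  continuous f -> continuous k -> continuous (fun x => k (f x)).
Proof. by move=> cf ck x; apply: continuous_comp; [exact: cf|exact: ck]. Qed.

End ContinuousFunctions.

Section StoneWeierstrass.
Variables (R : realType) (T : ptopologicalType).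
Hypothesis cptT : compact [set: T].
Implicit Types (f h p q : T -> R) (S : set (T -> R)).

Lemma continuous_compact_bounded f : continuous f ->
  exists2 M, 0 < M & forall x, `|f x| <= M.
Proof.
move=> cf; have c' : {within [set: T], continuous (fun x => `|f x|)}.
  by apply: continuous_subspaceT => x; apply: cvg_norm; exact: cf.
have [||c _ cM] := @compact_EVT_max T R (fun x => `|f x|) setT _ _ c'.
- by exists point.
- exact: cptT.
exists (`|f c| + 1); first by rewrite ltr_wpDl.
by move=> x; rewrite (le_trans (cM x _)) ?inE// lerDl.
Qed.

(** Each function p with p y < f y satisfies the inequality near y; by compactness
finitely many of them do so everywhere, and their minimum is again in S. *)
Lemma below_of_pointwise_below S f :
  (forall p q, S p -> S q -> S (fun x => Num.min (p x) (q x))) ->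
  (forall p, S p -> continuous p) -> continuous f ->
  (forall y, exists2 p, S p & p y < f y) ->
  exists2 p, S p & forall y, p y < f y.
Proof.
move=> Smin Scont cf pw.
have /choice[h hP] : forall y, exists p, S p /\ p y < f y.
  by move=> y; have [p Sp pf] := pw y; exists p.
have [Sh hf] : (forall y, S (h y)) /\ (forall y, h y y < f y).
  by split => y; have [] := hP y.
pose V y := [set z | h y z < f z].
have Vopen y : [set: T] y -> open (V y).
  move=> _; have -> : V y = (fun z => h y z - f z) @^-1` [set r | r < 0].
    by apply/seteqP; split => z /=; rewrite subr_lt0.
  apply: open_comp; last exact: open_lt.
  by move=> z _; apply: continuousB; [exact: Scont|exact: cf].
have cov : [set: T] `<=` cover setT V by move=> y _; exists y => //=; exact: hf.
have := cptT; rewrite compact_cover => /(_ _ _ _ Vopen cov) [D _ covD].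
pose m := foldr (fun y p x => Num.min (h y x) (p x)) (h point) (enum_fset D).
exists m; first by rewrite /m; elim: (enum_fset D) => //= y s IH; exact: Smin.
move=> y; have [i /= iD hi] := covD y I.
move: iD; rewrite -[_ \in D]/(i \in enum_fset D) /m => iD.
elim: (enum_fset D) iD => //= j s IH; rewrite inE gt_min => /orP[/eqP <-|/IH ->].
  by rewrite [h i y < f y]hi.
by rewrite orbT.
Qed.

Section Subalgebra.
Variable S : set (T -> R).
Hypothesis Scont : forall p, S p -> continuous p.
Hypothesis Scst : forall a : R, S (fun=> a).
Hypothesis Sadd : forall p q, S p -> S q -> S (fun x => p x + q x).
Hypothesis Smul : forall p q, S p -> S q -> S (fun x => p x * q x).

Definition uniform_closure : set (T -> R) :=
  [set f | forall e, 0 < e -> exists2 p, S p & forall x, `|f x - p x| < e].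

Local Notation U := uniform_closure.

Lemma uniform_closure_sub p : S p -> U p.
Proof. by move=> Sp e e0; exists p => // x; rewrite subrr normr0. Qed.

Lemma uniform_closure_idem f :
  (forall e, 0 < e -> exists2 p, U p & forall x, `|f x - p x| < e) -> U f.
Proof.
move=> Uf e e0; have e2 : 0 < e / 2 by rewrite divr_gt0.
have [p /(_ _ e2)[q Sq pq] fp] := Uf _ e2.
exists q => // x; rewrite -[f x - q x](subrKA (p x)) [ltRHS](splitr e).
by rewrite (le_lt_trans (ler_normD _ _))// ltrD.
Qed.

Lemma uniform_closure_continuous f : U f -> continuous f.
Proof.
move=> Uf x; apply/cvgrPdist_lt => e e0; have e3 : 0 < e / 3 by rewrite divr_gt0.
have [p Sp fp] := Uf _ e3; near=> y.
have -> : f x - f y = (f x - p x) + (p x - p y) - (f y - p y) by ring.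
have -> : e = e / 3 + e / 3 + e / 3 by field.
rewrite (le_lt_trans (ler_normB _ _))// ltrD//.
rewrite (le_lt_trans (ler_normD _ _))// ltrD//.
by near: y; move/cvgrPdist_lt: (Scont Sp (x := x)); exact.
Unshelve. all: by end_near. Qed.

Lemma uniform_closureD f h : U f -> U h -> U (fun x => f x + h x).
Proof.
move=> Uf Uh e e0; have e2 : 0 < e / 2 by rewrite divr_gt0.
have [p Sp fp] := Uf _ e2; have [q Sq hq] := Uh _ e2.
exists (fun x => p x + q x); first exact: Sadd.
move=> x; rewrite opprD addrACA [ltRHS](splitr e).
by rewrite (le_lt_trans (ler_normD _ _))// ltrD.
Qed.

Lemma uniform_closureZ a f : U f -> U (fun x => a * f x).
Proof.
move=> Uf e e0; have e2 : 0 < e / (`|a| + 1) by rewrite divr_gt0// ltr_wpDl.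
have [p Sp fp] := Uf _ e2.
exists (fun x => a * p x); first by apply: (Smul (p := fun=> a)).
move=> x; rewrite -mulrBr normrM.
apply: (@le_lt_trans _ _ ((`|a| + 1) * `|f x - p x|)).
  by rewrite ler_wpM2r// lerDl.
by rewrite mulrC -ltr_pdivlMr// ltr_wpDl.
Qed.

(** The iteration q <- q + (p^2 - q^2) / 2 increases from 0 to |p| at a rate that
does not depend on p, and it does not leave the algebra generated by p.  Signs are
written as products with -1 so that each step is literally a sum or a product. *)
Fixpoint abs_iter (n : nat) p : T -> R :=
  if n is n'.+1
  then fun x => abs_iter n' p x + 2^-1 * (p x * p x + -1 * (abs_iter n' p x * abs_iter n' p x))
  else fun=> 0.

Lemma abs_iter_in n p : S p -> S (abs_iter n p).
Proof.
move=> Sp; elim: n => [|n IH]; first exact: (Scst 0).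
apply: (Sadd (p := abs_iter n p)) => //.
apply: (Smul (p := fun=> 2^-1)) => //; apply: (Sadd (p := fun x => p x * p x)).
  exact: Smul.
by apply: (Smul (p := fun=> -1)) => //; exact: Smul.
Qed.

(** With a = |p x| and d = a - q, one step maps d to d (1 - a + d / 2), which is at
most d (1 - d / 2) because d <= a; so d decreases to 0 like 2 / n. *)
Lemma abs_iter_bound n p x : `|p x| <= 1 ->
  0 <= `|p x| - abs_iter n p x <= Num.min (`|p x|) (2 / n.+1%:R).
Proof.
set a := `|p x| => a1; have a0 : 0 <= a by rewrite normr_ge0.
elim: n => [|n] /=; first by rewrite subr0 a0 le_min lexx/= divr1; lra.
have -> : p x * p x = a * a by rewrite /a -normrM ger0_norm// -expr2 sqr_ge0.
set q := abs_iter n p x; set N : R := n.+1%:R.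
have N1 : 1 <= N by rewrite ler1n.
have -> : n.+2%:R = N + 1 by rewrite -natr1.
rewrite !le_min => /andP[d0 /andP[da dN]].
set d := a - q in d0 da dN.
have -> : a - (q + 2^-1 * (a * a + -1 * (q * q))) = d * (1 - a + d / 2).
  by rewrite /d; field.
have dd : d * (1 - a + d / 2) <= d * (1 - d / 2) by apply: ler_wpM2l => //; lra.
apply/and3P; split; first by apply: mulr_ge0 => //; lra.
  by apply: (le_trans dd); apply: (le_trans _ da); rewrite ler_piMr//; lra.
apply: (le_trans dd); have e0 : 0 <= N^-1 <= 1.
  by rewrite invr_ge0 (le_trans _ N1)//= invf_le1 ?(lt_le_trans _ N1).
set e := N^-1 in e0 dN.
have dle1 : d <= 1 by exact: le_trans da a1.
have [e2|e2] := leP e (2^-1); last first.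
  rewrite ler_pdivlMr; last lra.
  have eN : e * N = 1 by rewrite /e mulVf//; lra.
  have N2 : N <= 2 by nra.
  have : d * (1 - d / 2) <= 2^-1 by nra.
  nra.
have h1 : d * (1 - d / 2) <= 2 * e * (1 - e).
  rewrite -subr_ge0; have -> : 2 * e * (1 - e) - d * (1 - d / 2) =
    (2 * e - d) * (1 - (2 * e + d) / 2) by field.
  by apply: mulr_ge0; lra.
apply: (le_trans h1); rewrite ler_pdivlMr; last lra.
have -> : 2 * e * (1 - e) * (N + 1) = 2 - 2 * e ^+ 2.
  by rewrite /e; field; lra.
by rewrite gerBl mulr_ge0// sqr_ge0.
Qed.

Lemma uniform_closure_norm f : U f -> U (fun x => `|f x|).
Proof.
move=> Uf; apply: uniform_closure_idem => e e0.
have [p Sp fp] := Uf _ e0.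
exists (fun x => `|p x|); last first.
  by move=> x; exact: le_lt_trans (ler_dist_dist _ _) (fp x).
have [M M0 pM] := continuous_compact_bounded (Scont Sp).
pose q x := M^-1 * p x.
have Sq : S q by apply: (Smul (p := fun=> M^-1)).
have q1 x : `|q x| <= 1.
  by rewrite normrM gtr0_norm ?invr_gt0// mulrC ler_pdivrMr// mul1r.
have -> : (fun x => `|p x|) = fun x => M * `|q x|.
  by apply/funext => x; rewrite normrM gtr0_norm ?invr_gt0// mulVKf// gt_eqF.
apply: uniform_closureZ => d d0.
have [n nd] : exists n : nat, 2 / n.+1%:R < d.
  exists (Num.truncn (2 / d)); rewrite ltr_pdivrMr// mulrC -ltr_pdivrMr//.
  exact: truncnS_gt.
exists (abs_iter n q); first exact: abs_iter_in.
move=> x; have := abs_iter_bound n (q1 x).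
rewrite le_min => /andP[u0 /andP[_ un]]; rewrite ger0_norm//.
exact: le_lt_trans un nd.
Qed.

Lemma uniform_closure_min f h : U f -> U h -> U (fun x => Num.min (f x) (h x)).
Proof.
move=> Uf Uh.
have -> : (fun x => Num.min (f x) (h x)) =
    fun x => 2^-1 * ((f x + h x) + -1 * `|f x + -1 * h x|).
  apply/funext => x; rewrite !mulN1r.
  have [fh|/ltW hf] := leP (f x) (h x); rewrite -/(f x - h x).
    by rewrite ler0_norm ?subr_le0//; field.
  by rewrite ger0_norm ?subr_ge0//; field.
apply: uniform_closureZ; apply: uniform_closureD; first exact: uniform_closureD.
apply: uniform_closureZ; apply: uniform_closure_norm.
by apply: uniform_closureD => //; exact: uniform_closureZ.
Qed.

(** For each x, minima of functions of S that interpolate f at x and a second point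
stay below f + e / 2 and agree with f at x.  The opposites of these functions are
then minimised in turn, which squeezes f from both sides. *)
Theorem stone_weierstrass :
  (forall x y, x <> y -> exists2 p, S p & p x <> p y) ->
  forall f, continuous f -> U f.
Proof.
move=> sep f cf.
have interp x y : exists2 p, S p & p x = f x /\ p y = f y.
  have [<-|/eqP/sep[p Sp /eqP pxy]] := eqVneq x y.
    by exists (fun=> f x).
  pose a := (f y - f x) / (p y - p x).
  exists (fun z => a * p z + (f x - a * p x)).
    by apply: (Sadd (p := fun z => a * p z)) => //; apply: (Smul (p := fun=> a)).
  split; first by ring.
  by rewrite addrCA -mulrBr divfK ?subr_eq0 1?eq_sym// addrC subrK.
move=> e e0; have e2 : 0 < e / 2 by rewrite divr_gt0.
have above x : exists2 g, U g & g x = f x /\ forall y, g y < f y + e / 2.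
  pose S1 := [set g | U g /\ g x = f x].
  have [| | |y|g [Ug gx] gf] := @below_of_pointwise_below S1 (fun y => f y + e / 2).
  - move=> p q [Up px] [Uq qx]; split; first exact: uniform_closure_min.
    by rewrite px qx minxx.
  - by move=> p [/uniform_closure_continuous].
  - by move=> y; apply: cvgD; [exact: cf|exact: cvg_cst].
  - have [p Sp [px py]] := interp x y; exists p; last by rewrite py ltrDl.
    by split=> //; exact: uniform_closure_sub.
  - by exists g.
pose S2 := [set g | U g /\ forall y, - g y < f y + e / 2].
have [| | |x|g [Ug gf] fg] := @below_of_pointwise_below S2 (fun y => - f y + e / 2).
- move=> p q [Up pf] [Uq qf]; split; first exact: uniform_closure_min.
  by move=> y; rewrite oppr_min gt_max pf qf.
- by move=> p [/uniform_closure_continuous].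
- by move=> y; apply: cvgD; [apply: cvgN; exact: cf|exact: cvg_cst].
- have [g Ug [gx gf]] := above x; exists (fun y => -1 * g y); last first.
    by rewrite mulN1r gx ltrDl.
  by split; [exact: uniform_closureZ|move=> y; rewrite mulN1r opprK].
have [p Sp gp] := uniform_closureZ (-1) Ug e2.
exists p => // y; have := gp y; have := fg y; have := gf y.
rewrite mulN1r !ltr_norml => a b /andP[c d]; apply/andP; split; lra.
Qed.

End Subalgebra.
End StoneWeierstrass.

(** * One-variable calculus and linear differential systems *)

Section RealDerivatives.
Variable R : realType.
Implicit Types (f df : R -> R) (x d : R).

(** The form without difference quotients, in which h = 0 is not exceptional. *)
Lemma is_derive_epsP f x d : is_derive x (1 : R) f d <->
  forall e, 0 < e -> exists2 r, 0 < r &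
    forall h, `|h| < r -> `|f (x + h) - f x - h * d| <= e * `|h|.
Proof.
split=> [[dfx dE] e e0|H].
  have : h^-1 *: (f (h *: (1 : R) + x) - f x) @[h --> 0^'] --> d.
    by rewrite -dE; exact: dfx.
  move=> /cvgrPdist_le/(_ _ e0)/nbhs_ballP[r /= r0 rP]; exists r => // h hr.
  have [->|h0] := eqVneq h 0; first by rewrite addr0 subrr mul0r subrr normr0 mulr0.
  have : `|d - h^-1 *: (f (h *: (1 : R) + x) - f x)| <= e.
    by apply: rP => //; rewrite /ball /= sub0r normrN.
  rewrite [h *: 1]mulr1 [h + x]addrC /GRing.scale /= => de.
  have -> : f (x + h) - f x - h * d = - (h * (d - h^-1 * (f (x + h) - f x))).
    by field.
  by rewrite normrN normrM mulrC ler_wpM2r.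
have cv : h^-1 *: (f (h *: (1 : R) + x) - f x) @[h --> 0^'] --> d.
  apply/cvgrPdist_le => e e0; have [r r0 rP] := H _ e0.
  apply/nbhs_ballP; exists r => // h; rewrite /ball /= sub0r normrN => hr h0.
  rewrite [h *: 1]mulr1 [h + x]addrC /GRing.scale /=.
  have -> : d - h^-1 * (f (x + h) - f x) = - (h^-1 * (f (x + h) - f x - h * d)).
    by field.
  rewrite normrN normrM normfV mulrC ler_pdivrMr ?normr_gt0//; exact: rP.
by apply: DeriveDef; [apply/cvg_ex; exists d|exact: cvg_lim].
Qed.

Lemma is_derive_continuous f df : (forall x, is_derive x (1 : R) f (df x)) -> continuous f.
Proof.
by move=> H x; apply/differentiable_continuous/derivable1_diffP; case: (H x).
Qed.

Lemma mean_value f df a b : (forall x, is_derive x (1 : R) f (df x)) -> a < b ->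
  exists2 c, a < c < b & f b - f a = df c * (b - a).
Proof.
move=> H ab; have [|c cab E] := @MVT R f df a b ab (fun x _ => H x).
  exact: continuous_subspaceT (is_derive_continuous H).
by exists c => //; move: cab; rewrite in_itv.
Qed.

Lemma lipschitz_of_derivative_bound f df K : (forall x, is_derive x (1 : R) f (df x)) ->
  (forall x, `|df x| <= K) -> forall x y, `|f y - f x| <= K * `|y - x|.
Proof.
move=> H dK.
have lt x y : x < y -> `|f y - f x| <= K * `|y - x|.
  by move=> /(mean_value H)[c _ ->]; rewrite normrM ler_wpM2r.
move=> x y; have [xy|yx|->] := ltgtP x y; first exact: lt.
  by rewrite distrC [X in _ * X]distrC; exact: lt.
by rewrite !subrr normr0 mulr0.
Qed.

(** Only the past of x is constrained: this is the test in the time variable, where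
the maximum over a time interval may be reached at its right end. *)
Lemma derive_ge0_at_left_max f x d : is_derive x (1 : R) f d ->
  (exists2 y, y < x & forall z, y < z < x -> f z <= f x) -> 0 <= d.
Proof.
move=> /is_derive_epsP H [y yx ymax]; rewrite leNgt; apply/negP => d0.
have d2 : 0 < - d / 2 by rewrite divr_gt0// oppr_gt0.
have [r r0 rP] := H _ d2.
pose h := Num.min (r / 2) ((x - y) / 2).
have h0 : 0 < h by rewrite lt_min !divr_gt0// subr_gt0.
have hr : h < r by rewrite gt_min ltr_pdivrMr// ltr_pMr// ltr1n.
have hy : h < x - y by rewrite gt_min [X in _ || X]ltr_pdivrMr ?ltr_pMr ?subr_gt0 ?ltr1n ?orbT.
have := rP (- h); rewrite normrN gtr0_norm// => /(_ hr).
have fm : f (x - h) <= f x by apply: ymax; apply/andP; split; lra.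
rewrite ler_norml => /andP[+ _]; nra.
Qed.

(** If the second derivative were positive, the first one, which vanishes at x,
would be positive just after x, and f would exceed its maximum there. *)
Lemma derive2_le0_at_max f df x d2 : (forall y, is_derive y (1 : R) f (df y)) ->
  is_derive x (1 : R) df d2 -> (forall y, f y <= f x) -> d2 <= 0.
Proof.
move=> H /is_derive_epsP H2 fmax; rewrite leNgt; apply/negP => d0.
have df0 : df x = 0.
  have D := @derive1_at_max R f (x - 1) (x + 1) x.
  have : is_derive x (1 : R) f 0.
    apply: D; first lra.
    - by move=> t _; case: (H t).
    - by rewrite in_itv /=; apply/andP; split; lra.
    - by move=> t _; exact: fmax.
  by case: (H x) => _ <- [_ <-].
have e0 : 0 < d2 / 2 by rewrite divr_gt0.
have [r r0 rP] := H2 _ e0.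
have [c /andP[c1 c2] E] : exists2 c, x < c < x + r & f (x + r) - f x = df c * (x + r - x).
  by apply: mean_value => //; lra.
have := rP (c - x); rewrite subrKC df0 gtr0_norm ?subr_gt0//.
move=> /(_ ltac:(lra)); rewrite ler_norml => /andP[+ _].
have cx : 0 < c - x by lra.
rewrite (_ : x + r - x = r) in E; last by ring.
move=> dfc; have : 0 < df c by nra.
move=> /(mulr_gt0)/(_ r0); have := fmax (x + r); lra.
Qed.

Lemma is_derive_fin_sum (I : finType) (F : I -> R -> R) (dF : I -> R) x :
  (forall i, is_derive x (1 : R) (F i) (dF i)) ->
  is_derive x (1 : R) (fun t => \sum_i F i t) (\sum_i dF i).
Proof.
move=> H; elim: (index_enum I) => [|i s IH].
  by under eq_fun do rewrite big_nil; rewrite big_nil; exact: is_derive_cst.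
under eq_fun do rewrite big_cons; rewrite big_cons.
exact: is_deriveD.
Qed.

(** The derivative of an exponential generating series is the series of the shifted
sequence, which turns a linear differential system into a recursion. *)
Definition exp_series (b : R^nat) (t : R) : R := limn (pseries (fun k => k`!%:R^-1 * b k) t).

Lemma exp_series_cvg (b : R^nat) (K M t : R) : (forall k, `|b k| <= K * M ^+ k) ->
  cvgn (pseries (fun k => k`!%:R^-1 * b k) t).
Proof.
move=> bK; have K0 : 0 <= K by have := bK 0%N; rewrite expr0 mulr1; exact: le_trans.
apply: normed_cvg.
apply: (@series_le_cvg _ _ (fun k => K * exp_coeff (`|M * t|) k)) => [k|k|k|].
- exact: normr_ge0.
- by rewrite mulr_ge0// exp_coeff_ge0.
- rewrite /exp_coeff /= normrM normrM ger0_norm ?invr_ge0// normrX.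
  have -> : K * (`|M * t| ^+ k / k`!%:R) = K * `|M| ^+ k * (`|t| ^+ k / k`!%:R).
    by rewrite normrM exprMn; ring.
  have -> : k`!%:R^-1 * `|b k| * `|t| ^+ k = `|b k| * (`|t| ^+ k / k`!%:R) by ring.
  rewrite ler_wpM2r ?divr_ge0 ?exprn_ge0//.
  by rewrite (le_trans (bK k))// ler_wpM2l// -normrX ler_norm.
- exact: is_cvg_seriesZ (is_cvg_series_exp_coeff _).
Qed.

Lemma is_derive_exp_series (b : R^nat) (K M t : R) : (forall k, `|b k| <= K * M ^+ k) ->
  is_derive t (1 : R) (exp_series b) (exp_series (fun k => b k.+1) t).
Proof.
have diffs c : pseries_diffs (fun k => k`!%:R^-1 * c k) = (fun k => k`!%:R^-1 * c k.+1 : R).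
  apply/funext => k; rewrite /pseries_diffs factS natrM invfM mulrA mulrA mulfV ?mul1r//.
have shift (c : R^nat) (N : R) : (forall k, `|c k| <= N * M ^+ k) -> (forall k, `|c k.+1| <= (N * M) * M ^+ k).
  by move=> cN k; rewrite -mulrA -exprS.
move=> bK; rewrite /exp_series -diffs.
apply: (@pseries_snd_diffs _ _ (`|t| + 1)).
- exact: exp_series_cvg bK.
- rewrite diffs; apply: (@exp_series_cvg (fun k => b k.+1) (K * M) M); exact: (shift b K bK).
- by rewrite !diffs; apply: (@exp_series_cvg (fun k => b k.+2) (K * M * M) M); exact: (shift (fun k => b k.+1) (K * M) (shift b K bK)).
- by rewrite [ltRHS]ger0_norm ?addr_ge0// ltrDl.
Qed.

Lemma exp_series0 b : exp_series b 0 = b 0%N.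
Proof.
apply: lim_near_cst => //; near=> m.
rewrite /pseries /series /= -[m]prednK; last by near: m; exists 1%N.
rewrite big_nat_recl//= big1 ?addr0; first by rewrite fact0 invr1 expr0 mulr1 mul1r.
by move=> i _; rewrite expr0n mulr0.
Unshelve. all: by end_near. Qed.

Lemma exp_series_sum (I : finType) (a : I -> R) (b : I -> R^nat) (K M t : R) :
  (forall i k, `|b i k| <= K * M ^+ k) ->
  exp_series (fun k => \sum_i a i * b i k) t = \sum_i a i * exp_series (b i) t.
Proof.
move=> bK; rewrite /exp_series.
have -> : pseries (fun k => k`!%:R^-1 * \sum_i a i * b i k) t =
    (fun n => \sum_i a i * pseries (fun k => k`!%:R^-1 * b i k) t n).
  apply/funext => n; rewrite /pseries /series /=.
  under [RHS]eq_bigr do rewrite mulr_sumr.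
  rewrite exchange_big /=; apply: eq_bigr => k _.
  by rewrite mulr_sumr mulr_suml; apply: eq_bigr => i _; ring.
apply: cvg_lim => //; elim: (index_enum I) => [|i s IH].
  by under eq_fun do rewrite big_nil; rewrite big_nil; exact: cvg_cst.
under eq_fun do rewrite big_cons; rewrite big_cons.
apply: cvgD => //; apply: cvgMl_tmp; exact: exp_series_cvg (bK i).
Qed.

(** The coefficients b k are obtained from c0 by applying the transpose of A k times,
so the solution is the matrix exponential, written coordinate by coordinate. *)
Lemma linear_ode (I : finType) (A : I -> I -> R) (c0 : I -> R) :
  exists c : I -> R -> R, (forall i, c i 0 = c0 i) /\
    forall i t, is_derive t (1 : R) (c i) (\sum_j c j t * A j i).
Proof.
pose b := fix b k := if k is k'.+1 then fun i => \sum_j A j i * b k' j else c0.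
pose M := \sum_i \sum_j `|A j i|; pose K := \sum_i `|c0 i|.
have bK k i : `|b k i| <= K * M ^+ k.
  elim: k i => [|k IH] i /=.
    by rewrite expr0 mulr1 /K (bigD1 i)//= lerDl sumr_ge0.
  rewrite (le_trans (ler_norm_sum _ _ _))// exprSr mulrA /M mulr_sumr [leRHS](bigD1 i)//=.
  rewrite -[leLHS]addr0 lerD//; last first.
    apply: sumr_ge0 => j _; rewrite mulr_ge0 ?sumr_ge0//.
    exact: le_trans (normr_ge0 _) (IH i).
  by rewrite mulr_sumr; apply: ler_sum => j _; rewrite normrM mulrC ler_wpM2r.
exists (fun i => exp_series (fun k => b k i)); split=> [i|i t]; first exact: exp_series0.
apply: is_derive_eq; first exact: (@is_derive_exp_series _ K M).
rewrite (@exp_series_sum _ _ (fun j k => b k j) K M)//.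
by apply: eq_bigr => j _; rewrite mulrC.
Qed.

End RealDerivatives.

Section DerivativeLimit.
Variable R : realType.

Lemma harmonic_small (b e : R) : 0 < e -> exists m, b * harmonic m <= e.
Proof.
move=> e0; pose m := Num.truncn (b / e); exists m; rewrite /harmonic /=.
by rewrite ler_pdivrMr ?ltr0n// mulrC -ler_pdivrMr// ltW// truncnS_gt.
Qed.

Lemma le_of_harmonic (a b y : R) : (forall m, y <= a + b * harmonic m) -> y <= a.
Proof.
move=> H; apply/ler_addgt0Pr => e e0; have [m me] := harmonic_small b e0.
by rewrite (le_trans (H m))// lerD2l.
Qed.

(** The candidate l is the supremum of the lower bounds dF n x - K / (n + 1), all of
which lie below the upper bounds dF m x + K / (m + 1).  The differences F n - F m are
Lipschitz with a small constant; letting m grow, so is F n - f, and the derivative of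
F n at x then determines that of f up to a small error. *)
Lemma is_derive_limit (F dF : nat -> R -> R) (f : R -> R) (K x : R) : 0 <= K ->
  (forall n s, is_derive s (1 : R) (F n) (dF n s)) ->
  (forall n s, `|F n s - f s| <= K * harmonic n) ->
  (forall n m s, `|dF n s - dF m s| <= K * harmonic n + K * harmonic m) ->
  exists l, is_derive x (1 : R) f l /\ forall n, `|dF n x - l| <= K * harmonic n.
Proof.
move=> K0 FE Ff dFc; pose h n : R := K * harmonic n.
have sep n m : dF n x - h n <= dF m x + h m.
  by have := dFc n m x; rewrite -/(h n) -/(h m) ler_norml => /andP[_ ?]; lra.
pose E := [set dF n x - h n | n in [set: nat]].
have supE : has_sup E.
  split; first by exists (dF 0%N x - h 0%N), 0%N.
  by exists (dF 0%N x + h 0%N) => _ [n _ <-].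
pose l := sup E.
have ln n : `|dF n x - l| <= h n.
  have lo : dF n x - h n <= l by apply: sup_upper_bound => //; exists n.
  have hi : l <= dF n x + h n by apply: ge_sup => [|_ [m _ <-]]; [case: supE|exact: sep].
  by rewrite ler_norml; apply/andP; split; lra.
exists l; split=> //.
have lip n s : `|(F n s - f s) - (F n x - f x)| <= h n * `|s - x|.
  apply: (@le_of_harmonic _ (K * `|s - x| + 2 * K)) => m.
  have D : forall r, is_derive r (1 : R) (fun r => F n r - F m r) (dF n r - dF m r).
    by move=> r; apply: is_deriveB.
  have L := lipschitz_of_derivative_bound D (dFc n m) x s.
  have f1 := Ff m s; have f2 := Ff m x.
  have -> : F n s - f s - (F n x - f x) =
    ((F n s - F m s) - (F n x - F m x)) + (F m s - f s) - (F m x - f x) by ring.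
  rewrite (_ : _ + _ * harmonic m = (h n + h m) * `|s - x| + h m + h m); last first.
    by rewrite /h; ring.
  by rewrite (le_trans (ler_normB _ _))// lerD// (le_trans (ler_normD _ _))// lerD.
apply/is_derive_epsP => e e0; have e3 : 0 < e / 3 by rewrite divr_gt0.
have [n ne] := harmonic_small K e3.
have /is_derive_epsP/(_ _ e3)[r r0 rP] := FE n x.
exists r => // k kr.
have l1 := lip n (x + k); rewrite (_ : x + k - x = k) in l1; last by ring.
have -> : f (x + k) - f x - k * l = (F n (x + k) - F n x - k * dF n x) -
  ((F n (x + k) - f (x + k)) - (F n x - f x)) + k * (dF n x - l) by ring.
rewrite (_ : e * `|k| = e / 3 * `|k| + e / 3 * `|k| + e / 3 * `|k|); last by field.
rewrite (le_trans (ler_normD _ _))// lerD//; last first.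
  by rewrite normrM mulrC ler_wpM2r// (le_trans (ln n)).
rewrite (le_trans (ler_normB _ _))// lerD//; first exact: rP.
by rewrite (le_trans l1)// ler_wpM2r.
Qed.

End DerivativeLimit.

(** * One-parameter subgroups and linear forms on SU(2) *)

Section Matrices.
Variable R : realType.
Local Notation C := (cplx R).
Local Notation ofR := (fun x : R => (x%:C)%C : C).
Local Notation re := (fun z : C => complex.Re z).
Local Notation im := (fun z : C => complex.Im z).
Implicit Types (A : su2 R) (g h : SU2 R) (M N : 'M[C]_2).

Lemma reD (z w : C) : re (z + w) = re z + re w. Proof. by case: z w => ? ? []. Qed.
Lemma reZ (a : R) (z : C) : re (ofR a * z) = a * re z.
Proof. by case: z => x y /=; rewrite mul0r subr0. Qed.

Lemma ofRM (a b : R) : ofR a * ofR b = ofR (a * b).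
Proof. by rewrite [RHS]rmorphM. Qed.
Lemma ofRD (a b : R) : ofR a + ofR b = ofR (a + b).
Proof. by rewrite [RHS]rmorphD. Qed.

Lemma re_continuous : continuous (re : C -> R).
Proof.
move=> z; apply/(@cvgrPdist_lt _ _ _ (nbhs (z : C)) (nbhs_filter z)) => e e0.
have e0' : 0 < ofR e by rewrite ltcR.
apply: filterS (nbhsx_ballx (z : C) (ofR e) e0') => w zw; rewrite -ball_normE /= in zw; rewrite -ltcR (le_lt_trans _ zw)//.
have -> : re z - re w = re (z - w) by case: z w {zw} => ? ? [].
exact: normc_ge_Re.
Qed.

Lemma su2_trace A : \tr A = 0.
Proof. by have := su2valP A; rewrite inE => /andP[_ /eqP]. Qed.

(** A traceless A satisfies A^2 = - (det A) 1, and for A skew-Hermitian the determinant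
is a square r^2, so the exponential series splits into cosine and sine.  When r = 0,
A vanishes and the value of the quotient by r does not matter. *)
Lemma su2_exp_cos_sin A : exists r : R, (A : 'M[C]_2) *m A = ofR (- r ^+ 2) *: 1%:M /\
  (r = 0 -> (A : 'M[C]_2) = 0) /\
  forall t, su2_exp A t = ofR (cos (t * r)) *: 1%:M + ofR (sin (t * r) / r) *: (A : 'M[C]_2)
    :> 'M[C]_2.
Proof.
have [r dA A0] := skew_hermitian0_det (su2valP A).
exists r; split; [|split=> // t].
  rewrite trace0_sqr ?su2_trace// dA scalemx1; congr (_%:M).
  by rewrite -rmorphN.
rewrite /= (@expmx_su2 _ _ (t * r)); first last.
- move=> /eqP; rewrite mulf_eq0 => /orP[/eqP ->|/eqP/A0 ->]; last by rewrite scaler0.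
  by rewrite scale0r.
- by rewrite detZ dA !expr2 !ofRM; congr ofR; ring.
- by rewrite mxtraceZ su2_trace mulr0.
rewrite scalerA ofRM.
have [->|t0] := eqVneq t 0; first by rewrite !mul0r sin0 !(mul0r,mulr0).
have [r0|r0] := eqVneq r 0; first by rewrite (A0 r0) !scaler0.
congr (_ + ofR _ *: _); field; exact/andP.
Qed.

Lemma su2_expD A s t : (su2_exp A (s + t) = su2_exp A s * su2_exp A t)%g.
Proof.
have [r [sqA [A0 eA]]] := su2_exp_cos_sin A.
apply: val_inj => /=; rewrite -/(su2val _).
rewrite -[LHS]/(SU2val (su2_exp A (s + t))) -[RHS]/(su2_exp A s *m su2_exp A t) !eA.
rewrite mulmxDl !mulmxDr -!scalemxAl -!scalemxAr !mul1mx mulmx1 sqA !scalerA.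
rewrite !ofRM [X in _ = _ + X]addrC addrACA -!scalerDl !ofRD mulrDl cosD sinD.
have [r0|r0] := eqVneq r 0.
  by rewrite (A0 r0) !scaler0 r0 invr0 !(mulr0, mul0r) sin0 mulr0 subr0 !addr0.
by congr (ofR _ *: _ + ofR _ *: _); field.
Qed.

Lemma su2_exp0 A : su2_exp A 0 = 1%g.
Proof.
by apply: (@mulgI _ (su2_exp A 0)); rewrite -su2_expD addr0 mulg1.
Qed.

(** Every real-linear form on the 2 x 2 complex matrices is of this type, for one N.
Moving g along A replaces N by A N, so these functions are stable under all
left-invariant vector fields. *)
Definition lin_form N g : R := re (\tr (SU2val g *m N)).

Lemma lin_formD M N g : lin_form (M + N) g = lin_form M g + lin_form N g.
Proof. by rewrite /lin_form mulmxDr mxtraceD reD. Qed.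

Lemma lin_formB M N g : lin_form (M - N) g = lin_form M g - lin_form N g.
Proof.
have := lin_formD (M - N) N g; rewrite subrK => ->.
by rewrite addrK.
Qed.

Lemma lin_formZ a N g : lin_form (ofR a *: N) g = a * lin_form N g.
Proof. by rewrite /lin_form -scalemxAr mxtraceZ reZ. Qed.

Lemma lin_form_sum (I : finType) (F : I -> 'M[C]_2) g :
  lin_form (\sum_i F i) g = \sum_i lin_form (F i) g.
Proof.
elim/big_rec2 : _ => [|i y N _ <-]; last exact: lin_formD.
by rewrite /lin_form mulmx0 mxtrace0.
Qed.

Lemma lin_form_continuous N : continuous (lin_form N).
Proof.
have trE h : \tr (SU2val h *m N) = SU2val h 0 0 * N 0 0 + SU2val h 0 1 * N 1 0 +
    (SU2val h 1 0 * N 0 1 + SU2val h 1 1 * N 1 1).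
  by rewrite /mxtrace sum_ord2 !mxE !sum_ord2.
have entry i j : continuous (fun h : SU2 R => (SU2val h i j : C)).
  move=> g; apply: (cvg_comp (fun h : SU2 R => SU2val h) (fun M : 'M[C]_2 => M i j)).
    exact: (@initial_continuous _ _ (@SU2val R) g).
  exact: coord_continuous.
have -> : lin_form N = fun h => re (SU2val h 0 0 * N 0 0 + SU2val h 0 1 * N 1 0 +
    (SU2val h 1 0 * N 0 1 + SU2val h 1 1 * N 1 1)).
  by apply/funext => h; rewrite /lin_form trE.
apply: (@continuous_comp_fun (SU2 R) C R); last exact: re_continuous.
apply: (@continuous_add C (SU2 R)); apply: (@continuous_add C (SU2 R));
  apply: (@continuous_mul C (SU2 R)); (exact: entry || exact: continuous_cst).
Qed.

Lemma lin_form_flow A : exists r : R, (r = 0 -> forall N g, lin_form (A *m N) g = 0) /\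
  forall N g t, lin_form N (g * su2_exp A t)%g =
    cos (t * r) * lin_form N g + sin (t * r) / r * lin_form (A *m N) g.
Proof.
have [r [sqA [A0 eA]]] := su2_exp_cos_sin A; exists r; split.
  by move=> r0 N g; rewrite /lin_form (A0 r0) mul0mx mulmx0 mxtrace0.
move=> N g t; rewrite -!lin_formZ -lin_formD /lin_form.
rewrite -[SU2val (g * _)%g]/(SU2val g *m su2_exp A t) eA.
by rewrite -mulmxA mulmxDl -!scalemxAl mul1mx.
Qed.

End Matrices.

(** * Compactness of SU(2) *)

Section Compactness.
Variable R : realType.
Local Notation C := (cplx R).
Local Notation ofR := (fun x : R => (x%:C)%C : C).
Local Notation re := (fun z : C => complex.Re z).
Local Notation im := (fun z : C => complex.Im z).
Local Notation adj A := (map_mx Num.conj A^T).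
Implicit Types (A : su2 R) (g h : SU2 R) (M N : 'M[C]_2).

Lemma SU2_unitary g : SU2val g *m adj (SU2val g) = 1%:M.
Proof. by have := SU2valP g; rewrite inE => /andP[/unitarymxP]. Qed.

Lemma SU2_det g : \det (SU2val g) = 1.
Proof. by have := SU2valP g; rewrite inE => /andP[_ /eqP]. Qed.

(** The shape of the matrices of SU(2): the second row is determined by the first one. *)
Lemma SU2_entries g : SU2val g 0 0 * Num.conj (SU2val g 0 0) +
    SU2val g 0 1 * Num.conj (SU2val g 0 1) = 1 /\
  SU2val g 1 1 = Num.conj (SU2val g 0 0) /\ SU2val g 1 0 = - Num.conj (SU2val g 0 1).
Proof.
have /matrixP U := SU2_unitary g; have D := SU2_det g.
have := U 0 0; have := U 1 0; rewrite !mxE !sum_ord2 !mxE /= => u10 u00.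
rewrite det_mx22 in D; rewrite mulr1n in u00; rewrite mulr0n in u10.
move: (SU2val g 0 0) (SU2val g 0 1) (SU2val g 1 0) (SU2val g 1 1) => a b c d in D u10 u00 *.
set a' := Num.conj a in u00 u10 *; set b' := Num.conj b in u00 u10 *.
split=> //; split.
  have : d * (a * a' + b * b') = a' * (a * d - b * c) + b * (c * a' + d * b') by ring.
  by rewrite u00 D u10 !mulr1 mulr0 addr0.
have : c * (a * a' + b * b') = a * (c * a' + d * b') - b' * (a * d - b * c) by ring.
by rewrite u00 D u10 !mulr1 mulr0 add0r.
Qed.

(** Elementary matrices and their multiples by i recover all entries. *)
Lemma lin_form_separates g h : g <> h -> exists N, lin_form N g <> lin_form N h.
Proof.
move=> gh; apply: contrapT => H; apply: gh; apply: val_inj; apply/matrixP => i j.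
have eqN N : lin_form N g = lin_form N h.
  by apply: contrapT => E; apply: H; exists N.
have tr_delta g' : \tr (SU2val g' *m delta_mx j i) = SU2val g' i j.
  rewrite /mxtrace !sum_ord2 !mxE !sum_ord2 !mxE.
  by case: (ord2P i) => ->; case: (ord2P j) => ->;
    rewrite /= ?(mulr0, mulr1, mulr0n, mulr1n, addr0, add0r).
have := eqN ('i *: delta_mx j i); have := eqN (delta_mx j i).
rewrite /lin_form -!scalemxAr !mxtraceZ !tr_delta.
case: (SU2val g i j) (SU2val h i j) => [x y] [x' y'] /= ->.
by rewrite !mul0r !mul1r !sub0r => /oppr_inj ->.
Qed.

(** SU(2) is the image of the unit sphere of R^4 under this map.  Each entry is written
as a combination a x + b y of two coordinates, so that one continuity argument serves
for all four. *)
Definition sphere_mx (v : 'rV[R]_4) : 'M[C]_2 :=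
  mx22 (1 * ofR (v 0 0) + 'i * ofR (v 0 1)) (1 * ofR (v 0 2) + 'i * ofR (v 0 3))
       (-1 * ofR (v 0 2) + 'i * ofR (v 0 3)) (1 * ofR (v 0 0) + (- 'i) * ofR (v 0 1)).

Definition sphere : set 'rV[R]_4 :=
  [set v | v 0 0 ^+ 2 + v 0 1 ^+ 2 + v 0 2 ^+ 2 + v 0 3 ^+ 2 = 1].

Lemma sphere_compact : compact sphere.
Proof.
have cube := @rV_compact R 4 (fun=> `[-1, 1]%classic) (fun=> @segment_compact R (-1) 1).
apply: (subclosed_compact _ cube).
  have -> : sphere = (fun v : 'rV[R]_4 => v 0 0 ^+ 2 + v 0 1 ^+ 2 + v 0 2 ^+ 2 + v 0 3 ^+ 2)
    @^-1` [set 1] by [].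
  apply: closed_comp; last exact: closed_eq.
  move=> v _; move: v; rewrite -/(continuous _).
  do !apply: (@continuous_add R); apply: (@continuous_mul R); exact: coord_continuous.
move=> v; rewrite /sphere /= => v1 i; rewrite in_itv /= -ler_norml -(@expr_le1 _ 2)// real_normK ?num_real//.
rewrite -v1; have sq k : 0 <= v 0 k ^+ 2 by exact: sqr_ge0.
have [->|->|->|->] : [\/ i = 0, i = 1, i = 2 | i = 3].
  by case: i => -[|[|[|[|//]]]] Hi; [apply: Or41|apply: Or42|apply: Or43|apply: Or44]; apply: val_inj.
all: have := sq 0; have := sq 1; have := sq 2; have := sq 3; lra.
Qed.

Lemma sphere_mx_continuous : continuous sphere_mx.
Proof.
have comp k : continuous (fun v : 'rV[R]_4 => ofR (v 0 k)).
  apply: (@continuous_comp_fun 'rV[R]_4 R C); last exact: ofR_continuous.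
  exact: coord_continuous.
have comb (a b : C) k l : continuous (fun v : 'rV[R]_4 => a * ofR (v 0 k) + b * ofR (v 0 l)).
  by apply: (@continuous_add C); apply: (@continuous_mul C);
    [exact: continuous_cst|exact: comp|exact: continuous_cst|exact: comp].
have ent i j : continuous (fun v => sphere_mx v i j : C).
  by case: (ord2P i) => ->; case: (ord2P j) => ->; under eq_fun do rewrite mxE;
    exact: comb.
move=> v P [E vE sEP].
have H i j : nbhs (v : 'rV[R]_4) [set w | E i j (sphere_mx w i j)] := ent i j v _ (vE i j).
apply: (@filterS _ (nbhs (v : 'rV[R]_4)) (nbhs_filter _) _ _ _
  (filterI (filterI (H 0 0) (H 0 1)) (filterI (H 1 0) (H 1 1)))) => w [[? ?] [? ?]].
by apply: sEP => i j; case: (ord2P i) => ->; case: (ord2P j) => ->.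
Qed.

Definition sphere_coord g : 'rV[R]_4 :=
  \row_k [:: re (SU2val g 0 0); im (SU2val g 0 0); re (SU2val g 0 1); im (SU2val g 0 1)]`_k.

Lemma sphere_coordK g : sphere_mx (sphere_coord g) = SU2val g.
Proof.
have [_ [e11 e10]] := SU2_entries g.
apply/matrixP => i j; case: (ord2P i) => ->; case: (ord2P j) => ->; rewrite !mxE /=.
- by case: (SU2val g 0 0) => x y; congr Complex; rewrite /=; ring.
- by case: (SU2val g 0 1) => x y; congr Complex; rewrite /=; ring.
- by rewrite e10; case: (SU2val g 0 1) => x y; congr Complex; rewrite /=; ring.
- by rewrite e11; case: (SU2val g 0 0) => x y; congr Complex; rewrite /=; ring.
Qed.

Lemma sphere_coord_in g : sphere (sphere_coord g).
Proof.
have [+ _] := SU2_entries g; rewrite /sphere /= !mxE /=.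
case: (SU2val g 0 0) (SU2val g 0 1) => x y [x' y'] /= /(congr1 re) /= <-; ring.
Qed.

Lemma sphere_mx_su2 v : sphere v -> sphere_mx v \in @special_unitary R.
Proof.
move=> v1; have detE : \det (sphere_mx v) = 1.
  rewrite det_mx22 !mxE /= -[1 in RHS]/(Complex 1 0) -v1; congr Complex; rewrite /=; ring.
rewrite inE detE eqxx andbT; apply/unitarymxP/matrixP => i j.
by case: (ord2P i) => ->; case: (ord2P j) => ->; rewrite mxE sum_ord2 !mxE /=;
  rewrite ?mulr1n ?mulr0n; rewrite -?[1 in RHS]/(Complex 1 0) -?[0 in RHS]/(Complex 0 0) -?v1;
  congr Complex; rewrite /=; ring.
Qed.

(** The topology of SU(2) is induced by the inclusion in the matrices, so a cluster
point of the coordinates in the sphere yields one in the group. *)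
Lemma SU2_compact : compact [set: SU2 R].
Proof.
move=> F FF _.
have FFv := fmap_proper_filter sphere_coord FF.
have [|v0 [v01 clv0]] := sphere_compact FFv.
  by apply: (@filterS _ F _ setT) => [g _|]; [exact: sphere_coord_in|exact: filterT].
pose g0 := MkSU2 (sphere_mx_su2 v01).
exists g0; split=> // P B FP [_ [[B' B'o <-] B'g0] sB].
have nB : nbhs v0 (sphere_mx @^-1` B').
  by apply: sphere_mx_continuous; exact: open_nbhs_nbhs.
have [] := clv0 (sphere_coord @` P) _ _ nB.
  by apply: (@filterS _ F _ P) => // g Pg; exists g.
move=> _ [[g Pg <-]] /=; rewrite sphere_coordK => B'g.
by exists g; split=> //; exact: sB.
Qed.

End Compactness.

(** * Surjectivity of the exponential map *)

Section Exponential.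
Variable R : realType.
Local Notation C := (cplx R).
Local Notation ofR := (fun x : R => (x%:C)%C : C).
Local Notation re := (fun z : C => complex.Re z).
Local Notation im := (fun z : C => complex.Im z).
Local Notation adj A := (map_mx Num.conj A^T).
Implicit Types (A : su2 R) (g h : SU2 R) (M N : 'M[C]_2).

(** The general element of su(2), in coordinates adapted to Z, X and Y. *)
Definition skew_mx (y u v : R) : 'M[C]_2 :=
  mx22 (Complex 0 y) (Complex u v) (Complex (- u) v) (Complex 0 (- y)).

Lemma skew_mx_su2 y u v : skew_mx y u v \in @skew_hermitian0 R.
Proof.
rewrite inE; apply/andP; split.
  apply/eqP/matrixP => i j.
  by case: (ord2P i) => ->; case: (ord2P j) => ->; rewrite !mxE /=;
    congr Complex; rewrite /=; ring.
by rewrite /mxtrace sum_ord2 !mxE /=; apply/eqP; congr Complex; rewrite /=; ring.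
Qed.

Lemma skew_mx_det y u v : \det (skew_mx y u v) = ofR (y ^+ 2 + u ^+ 2 + v ^+ 2).
Proof. by rewrite det_mx22 !mxE /=; congr Complex; rewrite /=; ring. Qed.

Lemma su2_exp_unit y u v t : y ^+ 2 + u ^+ 2 + v ^+ 2 = 1 ->
  su2_exp (MkLie (skew_mx_su2 y u v)) t = ofR (cos t) *: 1%:M + ofR (sin t) *: skew_mx y u v
    :> 'M[C]_2.
Proof.
move=> yuv; rewrite /= (@expmx_su2 _ _ t); first last.
- by move=> ->; rewrite scale0r.
- by rewrite detZ skew_mx_det yuv !expr2 !ofRM mulr1.
- have := skew_mx_su2 y u v; rewrite inE => /andP[_ /eqP tr0].
  by rewrite mxtraceZ tr0 mulr0.
rewrite scalerA ofRM.
have [->|t0] := eqVneq t 0; first by rewrite mulr0 sin0.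
by rewrite divfK.
Qed.

(** For h in SU(2) with Re h00 = cos t, the matrix h - cos t is skew-Hermitian of
determinant sin^2 t, hence sin t times a unit element of su(2). *)
Lemma su2_exp_surjective h : exists y u v t, h = su2_exp (MkLie (skew_mx_su2 y u v)) t.
Proof.
have [n1 [e11 e10]] := SU2_entries h.
case E00 : (SU2val h 0 0) n1 e11 => [x y] n1 e11.
case E01 : (SU2val h 0 1) n1 e10 => [u v] n1 e10.
have {}n1 : x ^+ 2 + y ^+ 2 + u ^+ 2 + v ^+ 2 = 1.
  by have := congr1 re n1; rewrite /= => <-; ring.
have x1 : x \in `[-1, 1].
  rewrite in_itv /= -ler_norml -(@expr_le1 _ 2)// real_normK ?num_real// -n1.
  by rewrite -!addrA lerDl !addr_ge0// sqr_ge0.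
pose s := Num.sqrt (1 - x ^+ 2).
have s2 : s ^+ 2 = y ^+ 2 + u ^+ 2 + v ^+ 2.
  have E : 1 - x ^+ 2 = y ^+ 2 + u ^+ 2 + v ^+ 2 by rewrite -n1; ring.
  by rewrite sqr_sqrtr E// !addr_ge0// sqr_ge0.
have [y' [u' [v' [yuv [ey [eu ev]]]]]] : exists y' u' v',
    y' ^+ 2 + u' ^+ 2 + v' ^+ 2 = 1 /\ y = s * y' /\ u = s * u' /\ v = s * v'.
  have [s0|s0] := eqVneq s 0.
    (* h is 1 or -1 and the direction is arbitrary *)
    exists 1, 0, 0; rewrite s0 !mul0r; split; first by ring.
    have [] : 0 <= y ^+ 2 /\ 0 <= u ^+ 2 /\ 0 <= v ^+ 2 by rewrite !sqr_ge0.
    move=> y0 [u0 v0]; rewrite s0 expr0n /= in s2.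
    have sq0 (a : R) : a ^+ 2 <= 0 -> a = 0.
      by move=> a0; apply/eqP; rewrite -sqrf_eq0 eq_le a0 sqr_ge0.
    by repeat split; apply: sq0; lra.
  exists (y / s), (u / s), (v / s); split.
    by rewrite !expr_div_n -!mulrDl -s2 divff// expf_neq0.
  by repeat split; field.
exists y', u', v', (acos x); apply: val_inj => /=.
rewrite -[RHS]/(SU2val (su2_exp (MkLie (skew_mx_su2 y' u' v')) (acos x))) su2_exp_unit//.
rewrite acosK// sin_acos ?(itvP x1)// -/s.
apply/matrixP => i j; case: (ord2P i) => ->; case: (ord2P j) => ->; rewrite !mxE /=.
- by rewrite E00; congr Complex; rewrite /= ?ey; ring.
- by rewrite E01; congr Complex; rewrite /= ?eu ?ev; ring.
- by rewrite e10; congr Complex; rewrite /= ?eu ?ev; ring.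
- by rewrite e11; congr Complex; rewrite /= ?ey; ring.
Qed.

End Exponential.

(** * Lie derivatives *)

Section LieDerivatives.
Variable R : realType.
Local Notation C := (cplx R).
Local Notation ofR := (fun x : R => (x%:C)%C : C).
Implicit Types (A B : su2 R) (g h : SU2 R) (M N : 'M[C]_2) (f u v : SU2 R -> R).

Definition is_lderive A f g (d : R) : Prop :=
  is_derive (0 : R) (1 : R) (fun eps : R => f (g * su2_exp A eps)%g) d.

Lemma is_lderive_val A f g d : is_lderive A f g d -> lderive A f g = d.
Proof. by move=> H; rewrite /lderive derive1E; exact: (@derive_val _ _ _ _ _ _ _ H). Qed.

Lemma is_lderive_derivable A f g d : is_lderive A f g d -> lderivable A f g.
Proof. by case. Qed.

Lemma lderivableP A f g : lderivable A f g -> is_lderive A f g (lderive A f g).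
Proof. by move=> H; rewrite /lderive derive1E; exact: derivableP. Qed.

Lemma is_lderive_cst A a g : is_lderive A (fun=> a) g 0.
Proof. exact: is_derive_cst. Qed.

Lemma is_lderiveD A u v g du dv : is_lderive A u g du -> is_lderive A v g dv ->
  is_lderive A (fun h => u h + v h) g (du + dv).
Proof. exact: is_deriveD. Qed.

Lemma is_lderiveM A u v g du dv : is_lderive A u g du -> is_lderive A v g dv ->
  is_lderive A (fun h => u h * v h) g (u g * dv + v g * du).
Proof.
move=> Hu Hv; have := is_deriveM Hu Hv.
by rewrite su2_exp0 mulg1.
Qed.

Lemma is_lderive_lin_form A N g :
  is_lderive A (lin_form N) g (lin_form ((A : 'M[C]_2) *m N) g).
Proof.
have [r [r0 flow]] := lin_form_flow A; rewrite /is_lderive.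
under eq_fun do rewrite flow.
apply: is_derive_eq.
rewrite !(mul0r, sin0, cos0, scaler0, scale0r, add0r, oppr0, mul1r).
rewrite /GRing.scale /= mulr1.
have [z|z] := eqVneq r 0; first by rewrite (r0 z) mul0r.
by rewrite mulVf ?mulr1.
Qed.

(** The Lie derivative is defined at parameter 0; the group law of the one-parameter
subgroup transports it to every parameter. *)
Lemma is_derive_flow A f g t : lderivable A f (g * su2_exp A t)%g ->
  is_derive t (1 : R) (fun s => f (g * su2_exp A s)%g) (lderive A f (g * su2_exp A t)%g).
Proof.
move=> /lderivableP H.
have -> : (fun s => f (g * su2_exp A s)%g) =
  (fun e => f (g * su2_exp A t * su2_exp A e)%g) \o (fun s => s - t).
  by apply/funext => s /=; rewrite -mulgA -su2_expD addrC subrK.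
rewrite -[X in is_derive _ _ _ X]mulr1; apply: is_derive1_comp.
  by rewrite subrr; exact: H.
by apply: is_derive_eq; rewrite subr0.
Qed.

End LieDerivatives.

(** * Polynomial functions on SU(2) *)

Section Polynomials.
Variable R : realType.
Local Notation C := (cplx R).
Local Notation ofR := (fun x : R => (x%:C)%C : C).
Local Notation X := (su2X R).
Local Notation Y := (su2Y R).
Implicit Types (A B D E : su2 R) (g h : SU2 R) (M N : 'M[C]_2) (f u v : SU2 R -> R).

Local Opaque lderive.

(** The real algebra generated by the entries of the matrix, given by its generators:
derivability and identities between derivations follow by induction. *)
Inductive polyfun : (SU2 R -> R) -> Prop :=
| polyfun_lin N : polyfun (lin_form N)
| polyfun_cst a : polyfun (fun=> a)
| polyfunD u v : polyfun u -> polyfun v -> polyfun (fun g => u g + v g)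
| polyfunM u v : polyfun u -> polyfun v -> polyfun (fun g => u g * v g).

Lemma polyfunZ a u : polyfun u -> polyfun (fun g => a * u g).
Proof. by move=> pu; apply: polyfunM => //; exact: polyfun_cst. Qed.

Lemma polyfunB u v : polyfun u -> polyfun v -> polyfun (fun g => u g - v g).
Proof.
move=> pu pv; have -> : (fun g => u g - v g) = fun g => u g + -1 * v g.
  by apply/funext => g; rewrite mulN1r.
by apply: polyfunD => //; exact: polyfunZ.
Qed.

Lemma polyfun_sum (I : finType) (c : I -> R) (e : I -> SU2 R -> R) :
  (forall i, polyfun (e i)) -> polyfun (fun g => \sum_i c i * e i g).
Proof.
move=> pe; elim: (index_enum I) => [|i s IH].
  by under eq_fun do rewrite big_nil; exact: polyfun_cst.
by under eq_fun do rewrite big_cons; apply: polyfunD => //; exact: polyfunZ.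
Qed.

Lemma polyfun_continuous u : polyfun u -> continuous u.
Proof.
elim=> [N|a|? ? _ ? _ ?|? ? _ ? _ ?].
- exact: lin_form_continuous.
- exact: (@continuous_cst R (SU2 R)).
- exact: (@continuous_add R (SU2 R)).
- exact: (@continuous_mul R (SU2 R)).
Qed.

Lemma polyfun_lderive_ex u : polyfun u ->
  forall A, exists2 u', polyfun u' & forall g, is_lderive A u g (u' g).
Proof.
elim=> [N|a|{}u v pu IHu pv IHv|{}u v pu IHu pv IHv] A.
- by exists (lin_form ((A : 'M[C]_2) *m N)); [exact: polyfun_lin|move=> g; exact: is_lderive_lin_form].
- by exists (fun=> 0); [exact: polyfun_cst|move=> g; exact: is_lderive_cst].
- have [u' pu' Hu] := IHu A; have [v' pv' Hv] := IHv A.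
  by exists (fun g => u' g + v' g); [exact: polyfunD|move=> g; exact: is_lderiveD].
- have [u' pu' Hu] := IHu A; have [v' pv' Hv] := IHv A.
  exists (fun g => u g * v' g + v g * u' g); last by move=> g; exact: is_lderiveM.
  by apply: polyfunD; apply: polyfunM.
Qed.

Lemma polyfun_is_lderive A u g : polyfun u -> is_lderive A u g (lderive A u g).
Proof.
by move=> /polyfun_lderive_ex/(_ A)[u' _ H]; rewrite (is_lderive_val (H g)).
Qed.

Lemma polyfun_lderive A u : polyfun u -> polyfun (lderive A u).
Proof.
move=> /polyfun_lderive_ex/(_ A)[u' pu' H].
by have -> : lderive A u = u' by apply/funext => g; exact: is_lderive_val.
Qed.

Lemma polyfun_Ck k u : polyfun u -> is_Ck k u.
Proof.
elim: k u => [|k IH] u pu; split=> //; try exact: polyfun_continuous.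
move=> A; split; last by apply: IH; exact: polyfun_lderive.
by move=> g; exact: is_lderive_derivable (polyfun_is_lderive A g pu).
Qed.

Lemma lderiveD A u v g : polyfun u -> polyfun v ->
  lderive A (fun h => u h + v h) g = lderive A u g + lderive A v g.
Proof.
by move=> pu pv; apply/is_lderive_val/is_lderiveD; exact: polyfun_is_lderive.
Qed.

Lemma lderiveM A u v g : polyfun u -> polyfun v ->
  lderive A (fun h => u h * v h) g = u g * lderive A v g + v g * lderive A u g.
Proof.
by move=> pu pv; apply/is_lderive_val/is_lderiveM; exact: polyfun_is_lderive.
Qed.

Lemma lderive_cst A a g : lderive A (fun=> a) g = 0.
Proof. exact/is_lderive_val/is_lderive_cst. Qed.

Lemma lderiveZ A a u g : polyfun u -> lderive A (fun h => a * u h) g = a * lderive A u g.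
Proof.
by move=> pu; rewrite lderiveM ?lderive_cst ?mulr0 ?addr0//; exact: polyfun_cst.
Qed.

Lemma lderiveB A u v g : polyfun u -> polyfun v ->
  lderive A (fun h => u h - v h) g = lderive A u g - lderive A v g.
Proof.
move=> pu pv; rewrite (_ : (fun h => u h - v h) = fun h => u h + -1 * v h).
  by rewrite lderiveD ?lderiveZ ?mulN1r//; exact: polyfunZ.
by apply/funext => h; rewrite mulN1r.
Qed.

Lemma lderive_lin_form A N g :
  lderive A (lin_form N) g = lin_form ((A : 'M[C]_2) *m N) g.
Proof. exact/is_lderive_val/is_lderive_lin_form. Qed.

Lemma lderive_sum (I : finType) A (c : I -> R) (e : I -> SU2 R -> R) g :
  (forall i, polyfun (e i)) ->
  lderive A (fun h => \sum_i c i * e i h) g = \sum_i c i * lderive A (e i) g.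
Proof.
move=> pe; elim: (index_enum I) => [|i s IH].
  by rewrite big_nil; under [X in lderive A X]eq_fun do rewrite big_nil; exact: lderive_cst.
have ps : polyfun (fun h => \sum_(j <- s) c j * e j h).
  elim: {IH} s => [|j s IH].
    by under eq_fun do rewrite big_nil; exact: polyfun_cst.
  by under eq_fun do rewrite big_cons; apply: polyfunD => //; exact: polyfunZ.
rewrite big_cons; under [X in lderive A X]eq_fun do rewrite big_cons.
by rewrite lderiveD ?lderiveZ ?IH//; exact: polyfunZ.
Qed.

(** Both sides are derivations in u, so it is enough to compare them on linear forms,
where a Lie derivative multiplies the matrix N on the left. *)
Lemma lderive_linear A B D E a b c u g :
  (E : 'M[C]_2) = ofR a *: (A : 'M[C]_2) + ofR b *: (B : 'M[C]_2) + ofR c *: (D : 'M[C]_2) ->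
  polyfun u ->
  lderive E u g = a * lderive A u g + b * lderive B u g + c * lderive D u g.
Proof.
move=> ED; elim=> [N|x|{}u v pu IHu pv IHv|{}u v pu IHu pv IHv].
- by rewrite !lderive_lin_form ED !mulmxDl -!scalemxAl !lin_formD !lin_formZ.
- by rewrite !lderive_cst !mulr0 !addr0.
- by rewrite !lderiveD// IHu IHv; ring.
- by rewrite !lderiveM// IHu IHv; ring.
Qed.

(** A commutator of derivations is a derivation, so again linear forms suffice. *)
Lemma lderive_bracket A B D u g :
  (D : 'M[C]_2) = (A : 'M[C]_2) *m B - (B : 'M[C]_2) *m A -> polyfun u ->
  lderive A (lderive B u) g - lderive B (lderive A u) g = lderive D u g.
Proof.
move=> DE; elim=> [N|x|{}u v pu IHu pv IHv|{}u v pu IHu pv IHv].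
- have l2 A' B' : lderive A' (lderive B' (lin_form N)) g =
      lin_form ((A' : 'M[C]_2) *m B' *m N) g.
    rewrite (_ : lderive B' _ = lin_form ((B' : 'M[C]_2) *m N)).
      by rewrite lderive_lin_form mulmxA.
    by apply/funext => h; exact: lderive_lin_form.
  by rewrite (l2 A B) (l2 B A) lderive_lin_form DE mulmxBl lin_formB.
- have c0 A' : lderive A' (fun=> x) = fun=> 0 by apply/funext => h; exact: lderive_cst.
  by rewrite !c0 !lderive_cst subr0.
- have l2 A' B' : lderive A' (lderive B' (fun h => u h + v h)) g =
      lderive A' (lderive B' u) g + lderive A' (lderive B' v) g.
    rewrite (_ : lderive B' _ = fun h => lderive B' u h + lderive B' v h).
      by rewrite lderiveD//; exact: polyfun_lderive.
    by apply/funext => h; exact: lderiveD.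
  by rewrite (l2 A B) (l2 B A) (lderiveD D g pu pv) -IHu -IHv opprD addrACA.
- have l2 A' B' : lderive A' (lderive B' (fun h => u h * v h)) g =
      (u g * lderive A' (lderive B' v) g + lderive B' v g * lderive A' u g) +
      (v g * lderive A' (lderive B' u) g + lderive B' u g * lderive A' v g).
    rewrite (_ : lderive B' _ = fun h => u h * lderive B' v h + v h * lderive B' u h).
      have pBu := polyfun_lderive B' pu; have pBv := polyfun_lderive B' pv.
      by rewrite lderiveD ?lderiveM//; exact: polyfunM.
    by apply/funext => h; exact: lderiveM.
  rewrite (l2 A B) (l2 B A) (lderiveM D g pu pv) -IHu -IHv.
  move: (lderive A (lderive B u) g) (lderive B (lderive A u) g) (lderive A u g) (lderive B u g)
    (lderive A (lderive B v) g) (lderive B (lderive A v) g) (lderive A v g) (lderive B v g)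
    (u g) (v g) => *; ring.
Qed.

(** The linear forms already separate the points of the group. *)
Lemma polyfun_dense f : continuous f -> forall e : R, 0 < e ->
  exists2 p, polyfun p & forall g, `|f g - p g| < e.
Proof.
apply: (@stone_weierstrass R (SU2 R) (@SU2_compact R) polyfun).
- exact: polyfun_continuous.
- exact: polyfun_cst.
- exact: polyfunD.
- exact: polyfunM.
- move=> g h /lin_form_separates[N ghN]; exists (lin_form N) => //; exact: polyfun_lin.
Qed.

Lemma SU2_continuous_bounded f : continuous f -> exists2 M, 0 < M & forall g, `|f g| <= M.
Proof. exact: (@continuous_compact_bounded R (SU2 R) (@SU2_compact R)). Qed.

(** This makes the heat equation with polynomial initial data a finite linear system.
The linear forms are spanned by eight of them; sums are handled by disjoint unions
of families, products by families of products. *)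
Lemma polyfun_invariant_span u : polyfun u ->
  exists (I : finType) (e : I -> SU2 R -> R) (c : I -> R),
    [/\ forall i, polyfun (e i), u = (fun g => \sum_i c i * e i g) &
      forall A, exists M : I -> I -> R, forall i g, lderive A (e i) g = \sum_j M i j * e j g].
Proof.
elim=> [N|a|{}u v pu IHu pv IHv|{}u v pu IHu pv IHv].
- pose w (k : 'I_2 * 'I_2 * bool) : 'M[C]_2 :=
    (if k.2 then 'i : C else 1) *: delta_mx k.1.1 k.1.2.
  pose co (M : 'M[C]_2) (k : 'I_2 * 'I_2 * bool) : R :=
    if k.2 then complex.Im (M k.1.1 k.1.2) else complex.Re (M k.1.1 k.1.2).
  have expand M g : lin_form M g = \sum_k co M k * lin_form (w k) g.
    under eq_bigr do rewrite -lin_formZ; rewrite -lin_form_sum; congr lin_form.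
    rewrite [LHS]matrix_sum_delta pair_bigA /= -(pair_bigA _ (fun p b =>
      ofR (co M (p, b)) *: w (p, b))) /=.
    apply: eq_bigr => -[i j] _; rewrite big_bool /co /w /= !scalerA -scalerDl; congr (_ *: _).
    by case: (M i j) => x y; congr Complex; rewrite /=; ring.
  exists ('I_2 * 'I_2 * bool)%type, (fun k => lin_form (w k)), (co N); split.
  + by move=> k; exact: polyfun_lin.
  + by apply/funext => g; exact: expand.
  + move=> A; exists (fun k => co ((A : 'M[C]_2) *m w k)) => k g.
    by rewrite lderive_lin_form expand.
- exists unit, (fun _ _ => 1), (fun=> a); split.
  + by move=> _; exact: polyfun_cst.
  + by apply/funext => g; rewrite big_const card_unit /= addr0 mulr1.
  + by move=> A; exists (fun _ _ => 0) => i g; rewrite lderive_cst big1// => *; rewrite mul0r.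
- have [I [e [c [pe ue de]]]] := IHu; have [J [e' [c' [pe' ve de']]]] := IHv.
  exists (I + J)%type, (fun k => match k with inl i => e i | inr j => e' j end),
    (fun k => match k with inl i => c i | inr j => c' j end); split.
  + by case.
  + by apply/funext => g; rewrite big_sumType ue ve.
  + move=> A; have [M HM] := de A; have [M' HM'] := de' A.
    exists (fun k l => match k, l with inl i, inl i' => M i i' | inr j, inr j' => M' j j'
                       | _, _ => 0 end).
    move=> [i|j] g; rewrite big_sumType /=.
      by rewrite HM [X in _ + X]big1 ?addr0// => *; rewrite mul0r.
    by rewrite HM' [X in X + _]big1 ?add0r// => *; rewrite mul0r.
- have [I [e [c [pe ue de]]]] := IHu; have [J [e' [c' [pe' ve de']]]] := IHv.
  exists (I * J)%type, (fun k g => e k.1 g * e' k.2 g), (fun k => c k.1 * c' k.2); split.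
  + by move=> k; exact: polyfunM.
  + apply/funext => g; rewrite ue ve mulr_suml -(pair_bigA _ (fun i j =>
      c i * c' j * (e i g * e' j g))) /=.
    by apply: eq_bigr => i _; rewrite mulr_sumr; apply: eq_bigr => j _; ring.
  + move=> A; have [M HM] := de A; have [M' HM'] := de' A.
    exists (fun k l => (k.1 == l.1)%:R * M' k.2 l.2 + M k.1 l.1 * (k.2 == l.2)%:R).
    move=> [i j] g /=; rewrite lderiveM// HM HM' -(pair_bigA _ (fun i' j' =>
      ((i == i')%:R * M' j j' + M i i' * (j == j')%:R) * (e i' g * e' j' g))) /=.
    under [RHS]eq_bigr do (under eq_bigr do rewrite mulrDl; rewrite big_split).
    rewrite big_split /=; congr (_ + _).
      rewrite (bigD1 i)//= [X in _ + X]big1 ?addr0.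
        by rewrite mulr_sumr; apply: eq_bigr => j' _; rewrite eqxx mul1r; ring.
      by move=> i' i'i; rewrite big1// => j' _; rewrite eq_sym (negbTE i'i) !mul0r.
    rewrite mulr_sumr; apply: eq_bigr => i' _.
    rewrite (bigD1 j)//= [X in _ + X]big1 ?addr0; first by rewrite eqxx mulr1; ring.
    by move=> j' j'j; rewrite eq_sym (negbTE j'j) mulr0 mul0r.
Qed.

End Polynomials.

(** * The parabolic maximum principle *)

Section MaximumPrinciple.
Variable R : realType.
Local Notation X := (su2X R).
Local Notation Y := (su2Y R).
Implicit Types (A : su2 R) (g h : SU2 R) (f u v : SU2 R -> R).

Local Opaque lderive.

Definition lderivable2 A f :=
  (forall g, lderivable A f g) /\ (forall g, lderivable A (lderive A f) g).

Lemma polyfun_lderivable A u g : polyfun u -> lderivable A u g.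
Proof. by move=> pu; apply: is_lderive_derivable; exact: polyfun_is_lderive. Qed.

Lemma polyfun_lderivable2 A u : polyfun u -> lderivable2 A u.
Proof.
by move=> pu; split=> g; apply: polyfun_lderivable => //; exact: polyfun_lderive.
Qed.

Lemma lderive2_le0_at_max A f g : lderivable2 A f -> (forall h, f h <= f g) ->
  lderive A (lderive A f) g <= 0.
Proof.
move=> [df ddf] fmax.
apply: (@derive2_le0_at_max R (fun t => f (g * su2_exp A t)%g)
  (fun t => lderive A f (g * su2_exp A t)%g) 0).
- by move=> t; exact: is_derive_flow.
- exact: lderivableP.
- by move=> t; rewrite su2_exp0 mulg1; exact: fmax.
Qed.

(** If F exceeded M at time T, then F - d t, with a small d > 0, would reach its
maximum over [0, T] x SU(2) at a positive time.  There the time derivative of F is at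
least d while the second derivatives along X and Y are at most 0. *)
Lemma parabolic_max_principle (F dF : R -> SU2 R -> R) (M : R) :
  continuous (fun p : R * SU2 R => F p.1 p.2) ->
  (forall (t : R) g, is_derive t (1 : R) (F^~ g) (dF t g)) ->
  (forall t, lderivable2 X (F t) /\ lderivable2 Y (F t)) ->
  (forall (t : R) g, 0 < t -> dF t g <= subLaplacian (F t) g) ->
  (forall g, F 0 g <= M) ->
  forall (t : R) g, 0 <= t -> F t g <= M.
Proof.
move=> cF dFE F2 dFL F0 T g T0.
have [->|Tn0] := eqVneq T 0; first exact: F0.
have {T0 Tn0} T0 : 0 < T by rewrite lt_neqAle eq_sym Tn0.
apply/ler_addgt0Pr => e e0; pose d := e / T.
have d0 : 0 < d by rewrite divr_gt0.
pose G (p : R * SU2 R) := F p.1 p.2 + - d * p.1.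
have cG : continuous G.
  apply: (@continuous_add R (R * SU2 R)%type) => //; apply: (@continuous_mul R (R * SU2 R)%type).
    exact: continuous_cst.
  by move=> p; exact: cvg_fst.
have cpt : compact (`[0, T]%classic `*` [set: SU2 R]).
  by apply: compact_setX; [exact: segment_compact|exact: SU2_compact].
have ne : `[0, T]%classic `*` [set: SU2 R] !=set0.
  by exists (0, g); split=> //=; rewrite in_itv /= lexx ltW.
have [[t0 g0] /set_mem[/= t0T _] Gmax] := compact_EVT_max ne cpt (continuous_subspaceT cG).
rewrite in_itv /= in t0T; case/andP: t0T => t00 t0T.
have {}Gmax t h : 0 <= t <= T -> F t h + - d * t <= F t0 g0 + - d * t0.
  by move=> tT; apply: (Gmax (t, h)); rewrite inE; split=> //=; rewrite in_itv.
have [z|t0n0] := eqVneq t0 0.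
  have := Gmax T g; rewrite lexx ltW// => /(_ isT); rewrite z mulr0 addr0.
  move=> /le_trans/(_ (F0 g0)); rewrite mulNr /d divfK ?gt_eqF//; lra.
have {t0n0} t0pos : 0 < t0 by rewrite lt_neqAle eq_sym t0n0.
have Ht : d <= dF t0 g0.
  rewrite -subr_ge0; apply: (@derive_ge0_at_left_max R (fun t => F t g0 + - d * t) t0).
    have D1 := dFE t0 g0.
    have D2 : is_derive t0 (1 : R) (fun t : R => - d * t) (- d).
      by apply: is_derive_eq; rewrite [LHS]mulr1.
    exact: is_deriveD.
  by exists 0 => // z /andP[z0 zt]; apply: Gmax; apply/andP; split; lra.
have Fmax h : F t0 h <= F t0 g0.
  by have := Gmax t0 h; rewrite t00 t0T => /(_ isT); rewrite lerD2r.
have [X2 Y2] := F2 t0.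
have := lderive2_le0_at_max X2 Fmax; have := lderive2_le0_at_max Y2 Fmax.
have := dFL t0 g0 t0pos; rewrite /subLaplacian.
move: (lderive X _ g0) (lderive Y _ g0) (dF t0 g0) Ht => a b r; lra.
Qed.

(** Time and space variables are separated in a finite sum, so derivatives in time and
along the group commute, and joint continuity is immediate.  The second function is
the time derivative of the first. *)
Definition evolving_poly (u du : R -> SU2 R -> R) : Prop :=
  exists (I : finType) (e : I -> SU2 R -> R) (c dc : I -> R -> R),
    [/\ forall i, polyfun (e i),
        forall i t, is_derive t (1 : R) (c i) (dc i t),
        u = (fun t g => \sum_i c i t * e i g) &
        du = (fun t g => \sum_i dc i t * e i g)].

Section EvolvingPoly.
Variables u du : R -> SU2 R -> R.
Hypothesis ev : evolving_poly u du.

Lemma evolving_polyfun t : polyfun (u t).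
Proof. by case: ev => I [e [c [dc [pe _ -> _]]]]; exact: polyfun_sum. Qed.

Lemma evolving_is_derive t g : is_derive t (1 : R) (u^~ g) (du t g).
Proof.
case: ev => I [e [c [dc [_ dcE -> ->]]]].
apply: (@is_derive_fin_sum R I (fun i s => c i s * e i g)) => i.
have D := dcE i t; apply: is_derive_eq.
by rewrite scaler0 add0r [_ *: _]mulrC.
Qed.

Lemma evolving_continuous : continuous (fun p : R * SU2 R => u p.1 p.2).
Proof.
case: ev => I [e [c [dc [pe dcE -> _]]]].
apply: (@continuous_sum R (R * SU2 R)%type) => i.
apply: (@continuous_mul R (R * SU2 R)%type).
  apply: (@continuous_comp_fun (R * SU2 R)%type R R) => [p|]; first exact: cvg_fst.
  exact: is_derive_continuous (dcE i).
apply: (@continuous_comp_fun (R * SU2 R)%type (SU2 R) R) => [p|]; first exact: cvg_snd.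
exact: polyfun_continuous.
Qed.

Lemma evolving_lderive A :
  evolving_poly (fun t => lderive A (u t)) (fun t => lderive A (du t)).
Proof.
case: ev => I [e [c [dc [pe dcE -> ->]]]].
exists I, (fun i => lderive A (e i)), c, dc; split=> //.
- by move=> i; exact: polyfun_lderive.
- by apply/funext => t; apply/funext => g; exact: (lderive_sum A (c^~ t)).
- by apply/funext => t; apply/funext => g; exact: (lderive_sum A (dc^~ t)).
Qed.

Lemma evolving_bounded T : exists2 M, 0 < M & forall (t : R) g, 0 <= t <= T -> `|u t g| <= M.
Proof.
have [T0|T0] := leP 0 T; last first.
  by exists 1 => // t g /andP[t0 tT]; have := le_lt_trans (le_trans t0 tT) T0; rewrite ltxx.
have cpt : compact (`[0, T]%classic `*` [set: SU2 R]).
  by apply: compact_setX; [exact: segment_compact|exact: SU2_compact].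
have cu : continuous (fun p : R * SU2 R => `|u p.1 p.2|).
  apply: (@continuous_comp_fun (R * SU2 R)%type R R); first exact: evolving_continuous.
  exact: norm_continuous.
have ne : `[0, T]%classic `*` [set: SU2 R] !=set0.
  by exists (0, 1%g); split=> //=; rewrite in_itv /= lexx.
have [[t0 g0] _ umax] := compact_EVT_max ne cpt (continuous_subspaceT cu).
exists (`|u t0 g0| + 1); first by rewrite ltr_wpDl.
move=> t g tT; rewrite (le_trans (umax (t, g) _)) ?lerDl//.
by rewrite inE; split=> //=; rewrite in_itv.
Qed.
End EvolvingPoly.

End MaximumPrinciple.

(** * Brackets of the frame and commutators with the subLaplacian *)

Section Bernstein.
Variable R : realType.
Local Notation C := (cplx R).
Local Notation ofR := (fun x : R => (x%:C)%C : C).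
Local Notation X := (su2X R).
Local Notation Y := (su2Y R).
Implicit Types (A : su2 R) (g h : SU2 R) (f u v : SU2 R -> R).

Local Opaque lderive.

Lemma half_complex : (2^-1 : C) = Complex 2^-1 0.
Proof.
have -> : Complex 2^-1 0 = ofR (2^-1) by [].
by rewrite fmorphV /= rmorph_nat.
Qed.

(** The bracket of X and Y; the direction missing from the horizontal gradient. *)
Definition su2Z : su2 R := MkLie (skew_mx_su2 2^-1 0 0).
Local Notation Z := su2Z.

Lemma su2X_skew : (X : 'M[C]_2) = skew_mx 0 2^-1 0.
Proof.
apply/matrixP => i j; case: (ord2P i) => ->; case: (ord2P j) => ->;
  rewrite !mxE /= half_complex; congr Complex; rewrite /=; ring.
Qed.

Lemma su2Y_skew : (Y : 'M[C]_2) = skew_mx 0 0 2^-1.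
Proof.
apply/matrixP => i j; case: (ord2P i) => ->; case: (ord2P j) => ->;
  rewrite !mxE /= half_complex; congr Complex; rewrite /=; ring.
Qed.

Lemma skew_mx_bracket (y u v y' u' v' : R) :
  skew_mx y u v *m skew_mx y' u' v' - skew_mx y' u' v' *m skew_mx y u v =
  skew_mx (2 * (u * v' - v * u')) (2 * (v * y' - y * v')) (2 * (y * u' - u * y')).
Proof.
apply/matrixP => i j; case: (ord2P i) => ->; case: (ord2P j) => ->;
  rewrite !mxE !sum_ord2 !mxE /=; congr Complex; rewrite /=; ring.
Qed.

Lemma bracketXY u g : polyfun u ->
  lderive X (lderive Y u) g - lderive Y (lderive X u) g = lderive Z u g.
Proof.
apply: lderive_bracket; rewrite su2X_skew su2Y_skew skew_mx_bracket /=.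
by congr skew_mx; field.
Qed.

Lemma bracketYZ u g : polyfun u ->
  lderive Y (lderive Z u) g - lderive Z (lderive Y u) g = lderive X u g.
Proof.
apply: lderive_bracket; rewrite su2X_skew su2Y_skew skew_mx_bracket /=.
by congr skew_mx; field.
Qed.

Lemma bracketZX u g : polyfun u ->
  lderive Z (lderive X u) g - lderive X (lderive Z u) g = lderive Y u g.
Proof.
apply: lderive_bracket; rewrite su2X_skew su2Y_skew skew_mx_bracket /=.
by congr skew_mx; field.
Qed.

Lemma lderive_skew (a b c : R) u g : polyfun u ->
  lderive (MkLie (skew_mx_su2 a b c)) u g =
  2 * b * lderive X u g + 2 * c * lderive Y u g + 2 * a * lderive Z u g.
Proof.
apply: (@lderive_linear R X Y Z _ (2 * b) (2 * c) (2 * a)); rewrite su2X_skew su2Y_skew /=.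
apply/matrixP => i j; case: (ord2P i) => ->; case: (ord2P j) => ->;
  by rewrite !mxE /=; congr Complex; rewrite /=; field.
Qed.

Local Opaque su2X su2Y su2Z.

Lemma subLaplacian_poly u : polyfun u -> polyfun (subLaplacian u).
Proof.
move=> pu; apply: polyfunZ; apply: polyfunD; do 2 apply: polyfun_lderive; exact: pu.
Qed.

Lemma subLaplacianD u v g : polyfun u -> polyfun v ->
  subLaplacian (fun h => u h + v h) g = subLaplacian u g + subLaplacian v g.
Proof.
move=> pu pv; have l2 A : lderive A (lderive A (fun h => u h + v h)) g =
    lderive A (lderive A u) g + lderive A (lderive A v) g.
  have -> : lderive A (fun h => u h + v h) = fun h => lderive A u h + lderive A v h.
    by apply/funext => h; exact: lderiveD.
  by apply: lderiveD; exact: polyfun_lderive.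
rewrite /subLaplacian (l2 X) (l2 Y).
move: (lderive X (lderive X u) g) (lderive X (lderive X v) g) (lderive Y (lderive Y u) g)
  (lderive Y (lderive Y v) g) => *; ring.
Qed.

Lemma lderive2Z A a u g : polyfun u ->
  lderive A (lderive A (fun h => a * u h)) g = a * lderive A (lderive A u) g.
Proof.
move=> pu; have -> : lderive A (fun h => a * u h) = fun h => a * lderive A u h.
  by apply/funext => h; exact: lderiveZ.
by apply: lderiveZ; exact: polyfun_lderive.
Qed.

Lemma subLaplacianZ a u g : polyfun u ->
  subLaplacian (fun h => a * u h) g = a * subLaplacian u g.
Proof.
move=> pu; rewrite /subLaplacian (lderive2Z X a g pu) (lderive2Z Y a g pu).
move: (lderive X (lderive X u) g) (lderive Y (lderive Y u) g) => *; ring.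
Qed.

Lemma subLaplacian_sum (I : finType) (c : I -> R) (e : I -> SU2 R -> R) g :
  (forall i, polyfun (e i)) ->
  subLaplacian (fun h => \sum_i c i * e i h) g = \sum_i c i * subLaplacian (e i) g.
Proof.
move=> pe; have l2 A : lderive A (lderive A (fun h => \sum_i c i * e i h)) g =
    \sum_i c i * lderive A (lderive A (e i)) g.
  have -> : lderive A (fun h => \sum_i c i * e i h) = fun h => \sum_i c i * lderive A (e i) h.
    by apply/funext => h; exact: lderive_sum.
  by apply: lderive_sum => i; exact: polyfun_lderive.
rewrite /subLaplacian (l2 X) (l2 Y) -big_split mulr_sumr; apply: eq_bigr => i _ /=.
by rewrite -mulrDr mulrCA.
Qed.

(** The squared horizontal gradient measures how far L is from a derivation; it brings
the squared second derivatives into the estimate, with a negative sign. *)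
Lemma subLaplacian_sqr v g : polyfun v ->
  subLaplacian (fun h => v h * v h) g =
  2 * v g * subLaplacian v g + lderive X v g ^+ 2 + lderive Y v g ^+ 2.
Proof.
move=> pv; have l2 A : lderive A (lderive A (fun h => v h * v h)) g =
    2 * v g * lderive A (lderive A v) g + 2 * lderive A v g ^+ 2.
  have pAv := polyfun_lderive A pv.
  have -> : lderive A (fun h => v h * v h) = fun h => v h * lderive A v h + v h * lderive A v h.
    by apply/funext => h; exact: lderiveM.
  rewrite (@lderiveD R A _ _ g (polyfunM pv pAv) (polyfunM pv pAv)) (lderiveM A g pv pAv).
  by move: (lderive A (lderive A v) g) (lderive A v g) (v g) => a b c; ring.
rewrite /subLaplacian (l2 X) (l2 Y).
move: (lderive X (lderive X v) g) (lderive Y (lderive Y v) g) (lderive X v g) (lderive Y v g)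
  (v g) => a b c d e; by field.
Qed.

Lemma lderive_subLaplacian A u g : polyfun u -> lderive A (subLaplacian u) g =
  2^-1 * (lderive A (lderive X (lderive X u)) g + lderive A (lderive Y (lderive Y u)) g).
Proof.
move=> pu; have pXX := polyfun_lderive X (polyfun_lderive X pu).
have pYY := polyfun_lderive Y (polyfun_lderive Y pu).
by rewrite -(lderiveD A g pXX pYY) -(lderiveZ A 2^-1 g (polyfunD pXX pYY)).
Qed.

(** Used to apply the vector field A to the bracket relations. *)
Lemma lderive_congrB A u v w g : polyfun u -> polyfun v -> (forall h, u h - v h = w h) ->
  lderive A u g - lderive A v g = lderive A w g.
Proof.
by move=> pu pv uvw; rewrite -(lderiveB A g pu pv); congr (lderive A _ g); exact/funext.
Qed.

(** X (Y Y u) - Y Y (X u) = Z Y u + Y Z u, and Z Y = Y Z - X. *)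
Lemma lderiveX_subLaplacian u g : polyfun u ->
  lderive X (subLaplacian u) g =
  subLaplacian (lderive X u) g + lderive Y (lderive Z u) g - 2^-1 * lderive X u g.
Proof.
have alg (a1 a2 b c d w v : R) : a2 - b = d -> b - c = w -> w - d = v ->
  2^-1 * (a1 + a2) = 2^-1 * (a1 + c) + w - 2^-1 * v by lra.
move=> pu; have p A v : polyfun v -> polyfun (lderive A v) by exact: polyfun_lderive.
rewrite (lderive_subLaplacian X g pu).
have E1 := bracketXY g (p Y u pu).
have E2 : lderive Y (lderive X (lderive Y u)) g - lderive Y (lderive Y (lderive X u)) g =
    lderive Y (lderive Z u) g.
  by apply: lderive_congrB => [||h]; [do 2 apply: polyfun_lderive|do 2 apply: polyfun_lderive|exact: bracketXY].
have E3 := bracketYZ g pu.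
rewrite /subLaplacian.
exact: alg E1 E2 E3.
Qed.

(** Y (X X u) - X X (Y u) = - (Z X u + X Z u), and Z X = X Z + Y. *)
Lemma lderiveY_subLaplacian u g : polyfun u ->
  lderive Y (subLaplacian u) g =
  subLaplacian (lderive Y u) g - lderive X (lderive Z u) g - 2^-1 * lderive Y u g.
Proof.
have alg (a1 a2 b c d w v : R) : b - a1 = d -> c - b = w -> d - w = v ->
  2^-1 * (a1 + a2) = 2^-1 * (c + a2) - w - 2^-1 * v by lra.
move=> pu; have p A v : polyfun v -> polyfun (lderive A v) by exact: polyfun_lderive.
rewrite (lderive_subLaplacian Y g pu).
have E1 := bracketXY g (p X u pu).
have E2 : lderive X (lderive X (lderive Y u)) g - lderive X (lderive Y (lderive X u)) g =
    lderive X (lderive Z u) g.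
  by apply: lderive_congrB => [||h]; [do 2 apply: polyfun_lderive|do 2 apply: polyfun_lderive|exact: bracketXY].
have E3 := bracketZX g pu.
rewrite /subLaplacian.
exact: alg E1 E2 E3.
Qed.

(** Z generates rotations of the plane spanned by X and Y, which preserve X^2 + Y^2. *)
Lemma lderiveZ_subLaplacian u g : polyfun u ->
  lderive Z (subLaplacian u) g = subLaplacian (lderive Z u) g.
Proof.
have alg (a1 a2 b c d w v1 v2 : R) : a1 - b = v1 -> b - c = v2 -> d - a2 = v2 -> w - d = v1 ->
  2^-1 * (a1 + a2) = 2^-1 * (c + w) by lra.
move=> pu; have p A v : polyfun v -> polyfun (lderive A v) by exact: polyfun_lderive.
rewrite (lderive_subLaplacian Z g pu).
have E1 := bracketZX g (p X u pu).
have E2 : lderive X (lderive Z (lderive X u)) g - lderive X (lderive X (lderive Z u)) g =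
    lderive X (lderive Y u) g.
  by apply: lderive_congrB => [||h]; [do 2 apply: polyfun_lderive|do 2 apply: polyfun_lderive|exact: bracketZX].
have E3 := bracketYZ g (p Y u pu).
have E4 : lderive Y (lderive Y (lderive Z u)) g - lderive Y (lderive Z (lderive Y u)) g =
    lderive Y (lderive X u) g.
  by apply: lderive_congrB => [||h]; [do 2 apply: polyfun_lderive|do 2 apply: polyfun_lderive|exact: bracketYZ].
rewrite /subLaplacian.
exact: alg E1 E2 E3 E4.
Qed.

End Bernstein.

(** * The gradient estimate for the heat flow *)

Section Estimates.
Variable R : realType.
Local Notation X := (su2X R).
Local Notation Y := (su2Y R).
Local Notation Z := (su2Z R).
Implicit Types (A : su2 R) (g h : SU2 R) (f u v : SU2 R -> R).

Local Opaque lderive su2X su2Y su2Z.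

(** The weights of the horizontal and of the vertical part of the gradient.  With
E = exp (t / 5) the second one is (5 / 4) (E - 1)^2 / E, so that the first one, b, and
the second one, c, satisfy b' - b + b^2 / c = 1 and c' <= b / 2, which is what
the estimate requires. *)
Definition hweight (t : R) : R := expR (t / 5) - 1.
Definition vweight (t : R) : R := 5 / 4 * (expR (t / 5) - 2 + expR (- (t / 5))).

Lemma weights_at0 : hweight 0 = 0 /\ vweight 0 = 0.
Proof. by rewrite /hweight /vweight mul0r oppr0 expR0; split; ring. Qed.

(** Here x, y, z, p, q stand for X u, Y u, Z u, X Z u, Y Z u, and xx, xy, yx, yy for the
horizontal second derivatives.  Half of z^2 is contained in xy^2 + yx^2 because
z = xy - yx; completing the squares in x, q and in y, p leaves nonnegative terms. *)
Lemma bernstein_inequality (t x y z p q xx xy yx yy : R) : 0 < t -> xy - yx = z ->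
  - (x ^+ 2 + y ^+ 2) + 5^-1 * expR (t / 5) * (x ^+ 2 + y ^+ 2)
  + hweight t * (2 * x * q - x ^+ 2 - 2 * y * p - y ^+ 2
      - (xx ^+ 2 + yx ^+ 2 + xy ^+ 2 + yy ^+ 2))
  + 4^-1 * (expR (t / 5) - expR (- (t / 5))) * z ^+ 2
  - vweight t * (p ^+ 2 + q ^+ 2) <= 0.
Proof.
move=> t0 <-; rewrite /hweight /vweight expRN.
have : 1 < expR (t / 5) by rewrite expR_gt1 divr_gt0.
move: (expR (t / 5)) => E E1; have E0 : 0 < E by lra.
rewrite -oppr_ge0.
have -> : - (- (x ^+ 2 + y ^+ 2) + 5^-1 * E * (x ^+ 2 + y ^+ 2)
  + (E - 1) * (2 * x * q - x ^+ 2 - 2 * y * p - y ^+ 2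
      - (xx ^+ 2 + yx ^+ 2 + xy ^+ 2 + yy ^+ 2))
  + 4^-1 * (E - E^-1) * (xy - yx) ^+ 2
  - 5 / 4 * (E - 2 + E^-1) * (p ^+ 2 + q ^+ 2)) =
  (E - 1) * (xx ^+ 2 + yy ^+ 2 + 2^-1 * (xy + yx) ^+ 2)
  + (E - 1) ^+ 2 / (4 * E) * (xy - yx) ^+ 2
  + 4 * E / 5 * ((x - 5 * (E - 1) / (4 * E) * q) ^+ 2 + (y + 5 * (E - 1) / (4 * E) * p) ^+ 2).
  by field; lra.
have sq (a : R) : 0 <= a ^+ 2 by exact: sqr_ge0.
have E2 : 0 <= E - 1 by lra.
have E4 : 0 <= 4 * E by lra.
apply: addr_ge0; first apply: addr_ge0.
- by repeat first [exact: sq | done | apply: addr_ge0 | apply: mulr_ge0].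
- by repeat first [exact: sq | done | apply: divr_ge0 | apply: mulr_ge0].
- by repeat first [exact: sq | done | apply: addr_ge0 | apply: divr_ge0 | apply: mulr_ge0].
Qed.

Lemma weighted_is_derive (a x y z : R -> R) (da dx dy dz t : R) :
  is_derive t (1 : R) a da -> is_derive t (1 : R) x dx -> is_derive t (1 : R) y dy ->
  is_derive t (1 : R) z dz ->
  is_derive t (1 : R)
    (fun t => a t * a t + hweight t * (x t * x t + y t * y t) + vweight t * (z t * z t))
    (2 * a t * da + 5^-1 * expR (t / 5) * (x t ^+ 2 + y t ^+ 2)
     + hweight t * (2 * x t * dx + 2 * y t * dy)
     + 4^-1 * (expR (t / 5) - expR (- (t / 5))) * z t ^+ 2 + vweight t * (2 * z t * dz)).
Proof.
move=> Ha Hx Hy Hz; rewrite /hweight /vweight; apply: is_derive_eq.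
by rewrite /GRing.scale /=; field.
Qed.

Definition heat_flow (u : R -> SU2 R -> R) : Prop :=
  evolving_poly u (fun t => subLaplacian (u t)).

Lemma weights_ge0 t : 0 <= t -> 0 <= hweight t /\ 0 <= vweight t.
Proof.
move=> t0; have E1 : 1 <= expR (t / 5) by rewrite -expR0 ler_expR divr_ge0.
rewrite /hweight /vweight expRN; split; first by rewrite subr_ge0.
apply: mulr_ge0; first lra.
have -> : expR (t / 5) - 2 + (expR (t / 5))^-1 = (expR (t / 5) - 1) ^+ 2 / expR (t / 5).
  by field; rewrite gt_eqF ?expR_gt0.
by rewrite divr_ge0 ?sqr_ge0 ?expR_ge0.
Qed.

Lemma weights_continuous : continuous hweight /\ continuous vweight.
Proof.
have dh (t : R) : is_derive t (1 : R) hweight (expR (t / 5) / 5).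
  by rewrite /hweight; apply: is_derive_eq; rewrite /GRing.scale /=; field.
have dv (t : R) : is_derive t (1 : R) vweight (4^-1 * (expR (t / 5) - expR (- (t / 5)))).
  by rewrite /vweight; apply: is_derive_eq; rewrite /GRing.scale /=; field.
by split; [exact: is_derive_continuous dh|exact: is_derive_continuous dv].
Qed.

(** The left-hand side is the time derivative of the weighted function along the flow. *)
Lemma bernstein_subsolution u (t : R) g : polyfun u -> 0 < t ->
  2 * u g * subLaplacian u g
  + 5^-1 * expR (t / 5) * (lderive X u g ^+ 2 + lderive Y u g ^+ 2)
  + hweight t * (2 * lderive X u g * lderive X (subLaplacian u) g
     + 2 * lderive Y u g * lderive Y (subLaplacian u) g)
  + 4^-1 * (expR (t / 5) - expR (- (t / 5))) * lderive Z u g ^+ 2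
  + vweight t * (2 * lderive Z u g * lderive Z (subLaplacian u) g) <=
  subLaplacian (fun h => u h * u h + hweight t * (lderive X u h * lderive X u h
    + lderive Y u h * lderive Y u h) + vweight t * (lderive Z u h * lderive Z u h)) g.
Proof.
move=> pu t0.
have pX := polyfun_lderive X pu; have pY := polyfun_lderive Y pu.
have pZ := polyfun_lderive Z pu.
have puu := polyfunM pu pu; have pXX := polyfunM pX pX; have pYY := polyfunM pY pY.
have pZZ := polyfunM pZ pZ; have pXY := polyfunD pXX pYY.
have pb := polyfunZ (hweight t) pXY; have pc := polyfunZ (vweight t) pZZ.
rewrite (subLaplacianD g (polyfunD puu pb) pc) (subLaplacianD g puu pb).
rewrite (subLaplacianZ (hweight t) g pXY) (subLaplacianZ (vweight t) g pZZ).
rewrite (subLaplacianD g pXX pYY) (subLaplacian_sqr g pu) (subLaplacian_sqr g pX).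
rewrite (subLaplacian_sqr g pY) (subLaplacian_sqr g pZ).
rewrite (lderiveX_subLaplacian g pu) (lderiveY_subLaplacian g pu) (lderiveZ_subLaplacian g pu).
have alg (a l x y z lx ly lz p q xx yx xy yy : R) : xy - yx = z ->
  2 * a * l + 5^-1 * expR (t / 5) * (x ^+ 2 + y ^+ 2)
  + hweight t * (2 * x * (lx + q - 2^-1 * x) + 2 * y * (ly - p - 2^-1 * y))
  + 4^-1 * (expR (t / 5) - expR (- (t / 5))) * z ^+ 2 + vweight t * (2 * z * lz) <=
  2 * a * l + x ^+ 2 + y ^+ 2 + hweight t * (2 * x * lx + xx ^+ 2 + yx ^+ 2
    + (2 * y * ly + xy ^+ 2 + yy ^+ 2)) + vweight t * (2 * z * lz + p ^+ 2 + q ^+ 2).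
  move=> xyz; have := bernstein_inequality x y p q xx yy t0 xyz; rewrite -subr_le0 => H.
  rewrite -subr_le0; apply: le_trans H; rewrite le_eqVlt; apply/orP; left; apply/eqP; by field.
exact: alg (bracketXY g pu).
Qed.

(** The weighted function is at most M^2 at time 0, where the weights vanish, and the
maximum principle propagates this bound. *)
Lemma bernstein_estimate (u : R -> SU2 R -> R) (M : R) : heat_flow u -> (forall g, `|u 0 g| <= M) ->
  forall (t : R) g, 0 < t ->
  hweight t * (lderive X (u t) g ^+ 2 + lderive Y (u t) g ^+ 2) <= M ^+ 2 /\
  vweight t * lderive Z (u t) g ^+ 2 <= M ^+ 2.
Proof.
move=> hu uM t g t0.
have eX := evolving_lderive hu X; have eY := evolving_lderive hu Y.
have eZ := evolving_lderive hu Z.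
pose F t g := u t g * u t g + hweight t * (lderive X (u t) g * lderive X (u t) g
  + lderive Y (u t) g * lderive Y (u t) g) + vweight t * (lderive Z (u t) g * lderive Z (u t) g).
pose G t g : R := 2 * u t g * subLaplacian (u t) g
  + 5^-1 * expR (t / 5) * (lderive X (u t) g ^+ 2 + lderive Y (u t) g ^+ 2)
  + hweight t * (2 * lderive X (u t) g * lderive X (subLaplacian (u t)) g
     + 2 * lderive Y (u t) g * lderive Y (subLaplacian (u t)) g)
  + 4^-1 * (expR (t / 5) - expR (- (t / 5))) * lderive Z (u t) g ^+ 2
  + vweight t * (2 * lderive Z (u t) g * lderive Z (subLaplacian (u t)) g).
have pF s : polyfun (F s).
  have sq A : polyfun (fun g => lderive A (u s) g * lderive A (u s) g).
    by apply: polyfunM; apply: polyfun_lderive; exact: (evolving_polyfun hu).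
  apply: polyfunD; [apply: polyfunD|exact: polyfunZ].
    by apply: polyfunM; exact: (evolving_polyfun hu).
  by apply: polyfunZ; apply: polyfunD.
suff FM : F t g <= M ^+ 2.
  have nX : 0 <= lderive X (u t) g ^+ 2 by exact: sqr_ge0.
  have nY : 0 <= lderive Y (u t) g ^+ 2 by exact: sqr_ge0.
  have nZ : 0 <= lderive Z (u t) g ^+ 2 by exact: sqr_ge0.
  have nu : 0 <= u t g ^+ 2 by exact: sqr_ge0.
  have [h0 v0] := weights_ge0 (ltW t0).
  move: FM; rewrite /F -!expr2.
  have nh := mulr_ge0 h0 (addr_ge0 nX nY); have nv := mulr_ge0 v0 nZ.
  move=> FM; split; apply: le_trans FM.
    by rewrite -addrA addrCA lerDl addr_ge0.
  by rewrite lerDr addr_ge0.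
apply: (parabolic_max_principle (F := F) (dF := G)) (ltW t0) => //.
- have cts (k : R -> R) : continuous k ->
      continuous (fun p : R * SU2 R => k p.1).
    move=> ck; apply: (@continuous_comp_fun (R * SU2 R)%type R R) => [p|]; first exact: cvg_fst.
    exact: ck.
  have sq (w dw : R -> SU2 R -> R) : evolving_poly w dw ->
      continuous (fun p : R * SU2 R => w p.1 p.2 * w p.1 p.2).
    by move=> ev; apply: (@continuous_mul R (R * SU2 R)%type); exact: (evolving_continuous ev).
  have [ch cv] := weights_continuous.
  apply: (@continuous_add R (R * SU2 R)%type); first apply: (@continuous_add R (R * SU2 R)%type).
  + exact: sq hu.
  + apply: (@continuous_mul R (R * SU2 R)%type); first exact: cts ch.
    by apply: (@continuous_add R (R * SU2 R)%type); [exact: sq eX|exact: sq eY].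
  + by apply: (@continuous_mul R (R * SU2 R)%type); [exact: cts cv|exact: sq eZ].
- move=> s k; exact: (weighted_is_derive (evolving_is_derive hu s k) (evolving_is_derive eX s k)
    (evolving_is_derive eY s k) (evolving_is_derive eZ s k)).
- by move=> s; split; apply: polyfun_lderivable2.
- move=> s k s0; exact: (bernstein_subsolution k (evolving_polyfun hu s) s0).
- move=> k; rewrite /F; have [-> ->] := weights_at0; rewrite !mul0r !addr0 -expr2.
  by rewrite -real_normK ?num_real// lerXn2r ?nnegrE ?normr_ge0// (le_trans _ (uM k)).
Qed.

End Estimates.

(** * Existence of the heat flow, and harmonic functions *)

Section HeatFlow.
Variable R : realType.
Local Notation X := (su2X R).
Local Notation Y := (su2Y R).
Local Notation Z := (su2Z R).
Implicit Types (A : su2 R) (g h : SU2 R) (f v p : SU2 R -> R) (u : R -> SU2 R -> R).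

Local Opaque lderive su2X su2Y su2Z.

(** On an invariant span the subLaplacian acts by a matrix, half the sum of the squares
of those of X and Y. *)
Lemma heat_flow_exists p : polyfun p -> exists2 u, heat_flow u & u 0 = p.
Proof.
move=> /polyfun_invariant_span[I [e [c0 [pe pE closed]]]].
have [MX HX] := closed X; have [MY HY] := closed Y.
pose L i j := 2^-1 * (\sum_k MX i k * MX k j + \sum_k MY i k * MY k j).
have LE i g : subLaplacian (e i) g = \sum_j L i j * e j g.
  have l2 A M : (forall i g, lderive A (e i) g = \sum_j M i j * e j g) ->
      lderive A (lderive A (e i)) g = \sum_j (\sum_k M i k * M k j) * e j g.
    move=> HM; have -> : lderive A (e i) = fun h => \sum_k M i k * e k h.
      by apply/funext => h; exact: HM.
    rewrite lderive_sum//; under eq_bigr do rewrite HM mulr_sumr.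
    rewrite exchange_big /=; apply: eq_bigr => j _; rewrite mulr_suml.
    by apply: eq_bigr => k _; rewrite mulrA.
  rewrite /subLaplacian (l2 X MX HX) (l2 Y MY HY) -big_split mulr_sumr.
  by apply: eq_bigr => j _ /=; rewrite /L -mulrDl mulrA.
have [c [c0E dc]] := linear_ode L c0.
exists (fun t g => \sum_i c i t * e i g); last first.
  by rewrite pE; apply/funext => g; apply: eq_bigr => i _; rewrite c0E.
exists I, e, c, (fun i t => \sum_j c j t * L j i); split=> //.
apply/funext => t; apply/funext => g.
rewrite (subLaplacian_sum (c^~ t))//; under eq_bigr do rewrite LE mulr_sumr.
rewrite exchange_big /=; apply: eq_bigr => j _; rewrite mulr_suml.
by apply: eq_bigr => i _; rewrite mulrA.
Qed.

Lemma lderivable_sub A f v : (forall g, lderivable A f g) -> (forall g, lderivable A v g) ->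
  (forall g, lderivable A (fun h => f h - v h) g) /\
  lderive A (fun h => f h - v h) = (fun g => lderive A f g - lderive A v g).
Proof.
move=> df dv; have D g : is_lderive A (fun h => f h - v h) g (lderive A f g - lderive A v g).
  by apply: is_deriveB; exact: lderivableP.
split=> [g|]; first exact: is_lderive_derivable (D g).
by apply/funext => g; exact: is_lderive_val (D g).
Qed.

Lemma is_Ck2_lderivable2 A f : is_Ck 2 f -> lderivable2 A f.
Proof. by case=> _ /(_ A)[d1 [_ /(_ A)[d2 _]]]. Qed.

Lemma lderivable2_sub A f v : lderivable2 A f -> lderivable2 A v ->
  lderivable2 A (fun h => f h - v h) /\
  forall g, lderive A (lderive A (fun h => f h - v h)) g =
    lderive A (lderive A f) g - lderive A (lderive A v) g.
Proof.
move=> [f1 f2] [v1 v2]; have [d1 e1] := lderivable_sub f1 v1.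
have [d2 e2] := lderivable_sub f2 v2.
by rewrite /lderivable2 e1; split=> // g; rewrite e2.
Qed.

(** As L f = 0, both u - f and f - u solve the heat equation, so the maximum principle
bounds them by their initial values. *)
Lemma heat_flow_near_harmonic u f (e : R) : heat_flow u -> is_Ck 2 f -> SU2_harmonic f ->
  (forall g, `|f g - u 0 g| <= e) -> forall (t : R) g, 0 <= t -> `|f g - u t g| <= e.
Proof.
have alg1 (x1 x2 y1 y2 : R) : 2^-1 * (y1 + y2) = 0 ->
  2^-1 * (x1 + x2) <= 2^-1 * ((x1 - y1) + (x2 - y2)) by lra.
have alg2 (x1 x2 y1 y2 : R) : 2^-1 * (y1 + y2) = 0 ->
  - (2^-1 * (x1 + x2)) <= 2^-1 * ((y1 - x1) + (y2 - x2)) by lra.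
move=> hu f2 Lf fu.
have cu := evolving_continuous hu.
have cf : continuous (fun p : R * SU2 R => f p.2).
  apply: (@continuous_comp_fun (R * SU2 R)%type (SU2 R) R) => [p|]; first exact: cvg_snd.
  by case: f2.
have pu t := evolving_polyfun hu t.
have dX := is_Ck2_lderivable2 X f2; have dY := is_Ck2_lderivable2 Y f2.
have sub1 t A : lderivable2 A f -> _ := fun dA => lderivable2_sub (polyfun_lderivable2 A (pu t)) dA.
have sub2 t A : lderivable2 A f -> _ := fun dA => lderivable2_sub dA (polyfun_lderivable2 A (pu t)).
have M1 : forall (t : R) g, 0 <= t -> u t g - f g <= e.
  apply: (@parabolic_max_principle R (fun t g => u t g - f g) (fun t g => subLaplacian (u t) g)).
  - move=> p; apply: cvgB; [exact: cu|exact: cf].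
  - move=> t g; have D := evolving_is_derive hu t g.
    by apply: is_derive_eq; rewrite subr0.
  - by move=> t; split; [case: (sub1 t X dX)|case: (sub1 t Y dY)].
  - move=> t g _; have := Lf g; rewrite /subLaplacian => L0.
    case: (sub1 t X dX) => _ ->; case: (sub1 t Y dY) => _ ->.
    exact: alg1 L0.
  - by move=> g; rewrite (le_trans (ler_norm _))// distrC.
have M2 : forall (t : R) g, 0 <= t -> f g - u t g <= e.
  apply: (@parabolic_max_principle R (fun t g => f g - u t g) (fun t g => - subLaplacian (u t) g)).
  - move=> p; apply: cvgB; [exact: cf|exact: cu].
  - move=> t g; have D := evolving_is_derive hu t g.
    by apply: is_derive_eq; rewrite add0r mul1r.
  - by move=> t; split; [case: (sub2 t X dX)|case: (sub2 t Y dY)].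
  - move=> t g _; have := Lf g; rewrite /subLaplacian => L0.
    case: (sub2 t X dX) => _ ->; case: (sub2 t Y dY) => _ ->.
    exact: alg2 L0.
  - by move=> g; rewrite (le_trans (ler_norm _)).
by move=> t g t0; rewrite ler_norml; apply/andP; split;
  [rewrite lerNl opprB; exact: M1|exact: M2].
Qed.

Lemma weights_large (N : R) : exists2 t : R, 0 < t & N <= hweight t /\ N <= vweight t.
Proof.
pose K := `|N| + 1; have K1 : 1 <= K by rewrite lerDr.
have NK : N <= K - 1 by rewrite addrK ler_norm.
exists (5 * K); first by rewrite mulr_gt0// (lt_le_trans _ K1).
rewrite /hweight /vweight (_ : 5 * K / 5 = K); last by field.
have := expR_ge1Dx K; have := expR_gt0 (- K); split; lra.
Qed.

(** The flow u started near f stays near f while its derivatives along X, Y and Z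
become small; so f takes nearly the same value at 1 and at exp (s A), for every A. *)
Lemma harmonic_constant f : is_Ck 2 f -> SU2_harmonic f -> exists a, forall g, f g = a.
Proof.
move=> f2 Lf; exists (f 1%g) => h.
have cf : continuous f by case: f2.
have [a [b [c [s ->]]]] := su2_exp_surjective h.
set A := MkLie _.
have [M0 M00 fM] := SU2_continuous_bounded cf.
apply/eqP; rewrite -subr_eq0 -normr_le0; apply/ler_addgt0Pr => e e0; rewrite add0r.
pose d := Num.min 1 (e / 4).
have d0 : 0 < d by rewrite lt_min ltr01 divr_gt0.
have [p pp fp] := polyfun_dense cf d0.
have [u hu u0] := heat_flow_exists pp.
pose M := M0 + 1.
have uM g : `|u 0 g| <= M.
  rewrite u0 -(subrK (f g) (p g)) (le_trans (ler_normD _ _))// addrC lerD//.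
  by rewrite distrC (le_trans (ltW (fp g)))// ge_min lexx.
(* A bound r on the three derivatives makes u almost invariant under right
   multiplication by the element considered. *)
pose W := `|s| * (2 * `|b| + 2 * `|c| + 2 * `|a|) + 1.
have W0 : 0 < W by rewrite ltr_wpDl// mulr_ge0// !addr_ge0// mulr_ge0.
pose r := e / 2 / W; have r0 : 0 < r by rewrite !divr_gt0.
have [t t0 [hN vN]] := weights_large (M ^+ 2 / r ^+ 2).
have small (w x : R) : M ^+ 2 / r ^+ 2 <= w -> w * x ^+ 2 <= M ^+ 2 -> `|x| <= r.
  move=> Nw wx; suff : `|x| ^+ 2 <= r ^+ 2 by rewrite ler_pXn2r// nnegrE ltW.
  rewrite real_normK ?num_real//.
  have M2 : 0 < M ^+ 2 by rewrite exprn_gt0// addr_gt0.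
  have := le_trans (ler_wpM2r (sqr_ge0 x) Nw) wx.
  by rewrite mulrAC ler_pdivrMr ?exprn_gt0// ler_pM2l.
have h0 : 0 <= hweight t by rewrite (le_trans _ hN)// divr_ge0 ?sqr_ge0.
have dX g : `|lderive X (u t) g| <= r.
  have [EX _] := bernstein_estimate hu uM g t0; apply: small hN _.
  by apply: le_trans EX; rewrite ler_wpM2l// lerDl sqr_ge0.
have dY g : `|lderive Y (u t) g| <= r.
  have [EX _] := bernstein_estimate hu uM g t0; apply: small hN _.
  by apply: le_trans EX; rewrite ler_wpM2l// lerDr sqr_ge0.
have dZ g : `|lderive Z (u t) g| <= r.
  by have [_ EZ] := bernstein_estimate hu uM g t0; exact: small vN EZ.
have pu := evolving_polyfun hu t.
have dA g : `|lderive A (u t) g| <= (2 * `|b| + 2 * `|c| + 2 * `|a|) * r.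
  rewrite (lderive_skew a b c g pu).
  have n2 (x y : R) : `|y| <= r -> `|2 * x * y| <= 2 * `|x| * r.
    by move=> yr; rewrite !normrM ger0_norm// ler_wpM2l// mulr_ge0.
  rewrite (le_trans (ler_normD _ _))// [leRHS]mulrDl lerD ?n2//.
  by rewrite (le_trans (ler_normD _ _))// [leRHS]mulrDl lerD ?n2.
have usmall : `|u t (su2_exp A s) - u t 1%g| <= e / 2.
  have := @lipschitz_of_derivative_bound R (fun z => u t (1 * su2_exp A z)%g)
    (fun z => lderive A (u t) (1 * su2_exp A z)%g) _
    (fun z => is_derive_flow (@polyfun_lderivable R A (u t) (1 * su2_exp A z)%g pu))
    (fun z => dA (1 * su2_exp A z)%g) 0 s.
  rewrite su2_exp0 !mul1g subr0 => /le_trans; apply.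
  rewrite mulrAC /r mulrA ler_pdivrMr// mulrC ler_pM2l ?divr_gt0//.
  by rewrite mulrC lerDl.
have near g : `|f g - u t g| <= d.
  by apply: (heat_flow_near_harmonic hu f2 Lf) (ltW t0) => k; rewrite u0 ltW.
have de : d <= e / 4 by rewrite ge_min lexx orbT.
have N1 := near (su2_exp A s); have N2 := near 1%g.
clearbody A; move: usmall N1 N2; rewrite !ler_norml.
move: (f (su2_exp A s)) (f 1%g) (u t (su2_exp A s)) (u t 1%g) => y1 y2 z1 z2.
clear -de; move=> /andP[? ?] /andP[? ?] /andP[? ?]; apply/andP; split; lra.
Qed.

End HeatFlow.

(** * Bounded measurable functions on SU(2) *)

Section BoundedMeasurable.
Variable R : realType.
Implicit Types (g h : SU2 R) (phi psi : SU2 R -> R) (D : set (SU2 R)).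

Definition bounded_measurable phi : Prop :=
  measurable_fun [set: SU2 R] phi /\ exists M, forall g, `|phi g| <= M.

Lemma bounded_measurable_continuous phi : continuous phi -> bounded_measurable phi.
Proof.
move=> cphi; split; last by have [M _ HM] := SU2_continuous_bounded cphi; exists M.
apply: (measurability _ (RGenOInfty.measurableE R)).
move=> /= _ [_ [x ->] <-]; rewrite setTI.
apply: sub_sigma_algebra; apply: open_comp => [y _|]; first exact: cphi.
exact: interval_open.
Qed.

Lemma bounded_measurable_indic D : measurable D -> bounded_measurable (\1_D : SU2 R -> R).
Proof.
move=> mD; split; first exact: measurable_indic.
by exists 1 => g; rewrite indicE ger0_norm ?lern1 ?leq_b1.
Qed.

Lemma bounded_measurableZ a phi : bounded_measurable phi ->
  bounded_measurable (fun g => a * phi g).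
Proof.
move=> [mphi [M phiM]]; split; first exact: measurable_funM.
by exists (`|a| * M) => g; rewrite normrM ler_wpM2l.
Qed.

Lemma bounded_measurableD phi psi : bounded_measurable phi -> bounded_measurable psi ->
  bounded_measurable (fun g => phi g + psi g).
Proof.
move=> [mphi [M phiM]] [mpsi [N psiN]]; split; first exact: measurable_funD.
by exists (M + N) => g; rewrite (le_trans (ler_normD _ _))// lerD.
Qed.

Lemma bounded_measurableB phi psi : bounded_measurable phi -> bounded_measurable psi ->
  bounded_measurable (fun g => phi g - psi g).
Proof.
move=> [mphi [M phiM]] [mpsi [N psiN]]; split; first exact: measurable_funB.
by exists (M + N) => g; rewrite (le_trans (ler_normB _ _))// lerD.
Qed.

Lemma bounded_measurable_sum n (a : 'I_n -> R) (F : 'I_n -> SU2 R -> R) :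
  (forall i, bounded_measurable (F i)) -> bounded_measurable (fun g => \sum_i a i * F i g).
Proof.
move=> bF; elim: (index_enum 'I_n) => [|i s IH].
  under eq_fun do rewrite big_nil; split; first exact: measurable_cst.
  by exists 0 => g; rewrite normr0.
under eq_fun do rewrite big_cons.
by apply: bounded_measurableD => //; exact: bounded_measurableZ.
Qed.

(** Counting the levels (k + 1) e that v reaches gives v up to e, until the staircase
stops at N e. *)
Lemma staircase (e v : R) (N : nat) : 0 < e -> 0 <= v ->
  let F := \sum_(k < N) e * (k.+1%:R * e <= v)%R%:R in
  (v < N%:R * e -> v - e < F <= v) /\ (N%:R * e <= v -> F = N%:R * e).
Proof.
move=> e0 v0; elim: N => [|N [IH1 IH2]] /=.
  by rewrite mul0r big_ord0; split=> // /(le_lt_trans v0); rewrite ltxx.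
rewrite big_ord_recr /=; move: IH1 IH2; set F := \sum_(_ < _) _ => IH1 IH2.
have -> : N.+1%:R * e = N%:R * e + e by rewrite -natr1 mulrDl mul1r.
case: (ltP v (N%:R * e + e)) => v1; split=> // _ /=.
- rewrite mulr0 addr0; case: (ltP v (N%:R * e)) => [/IH1//|v2].
  by rewrite (IH2 v2) v2 andbT; lra.
- by rewrite mulr1 IH2//; lra.
Qed.

(** The function phi + M is nonnegative and is approximated by the staircase of its
superlevel sets; the index 0 carries the constant - M. *)
Lemma bounded_measurable_simple phi (e : R) : bounded_measurable phi -> 0 < e ->
  exists n (a : 'I_n -> R) (D : 'I_n -> set (SU2 R)), (forall i, measurable (D i)) /\
    forall g, `|phi g - \sum_i a i * \1_(D i) g| <= e.
Proof.
move=> [mphi [M phiM]] e0.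
have M0 : 0 <= M by exact: le_trans (phiM 1%g).
pose N := (Num.truncn (2 * M / e)).+1.
have NM : 2 * M < N%:R * e by rewrite -ltr_pdivrMr// truncnS_gt.
pose E k : set (SU2 R) := phi @^-1` `[k%:R * e - M, +oo[%classic.
exists N.+1, (fun i => if (i == 0 :> nat) then - M else e),
  (fun i => if (i == 0 :> nat) then setT else E i); split.
  move=> i; case: ifP => // _; rewrite -[E _]setTI; apply: mphi => //.
move=> g; rewrite big_ord_recl /= indicT mulr1.
have v0 : 0 <= phi g + M by have := phiM g; rewrite ler_norml => /andP[+ _]; lra.
have vN : phi g + M < N%:R * e.
  by apply: le_lt_trans NM; have := phiM g; rewrite ler_norml => /andP[_ +]; lra.
have [/(_ vN) + _] := staircase N e0 v0.
have -> : \sum_(i < N) e * \1_(E (bump 0 i)) g = \sum_(k < N) e * (k.+1%:R * e <= phi g + M)%R%:R.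
  apply: eq_bigr => i _; rewrite indicE; congr (_ * (nat_of_bool _)%:R).
  by apply/idP/idP => [/set_mem|?]; [|apply/mem_set];
    rewrite /E /= in_itv /= andbT lerBlDr.
move=> /andP[h1 h2]; rewrite ler_norml; apply/andP; split; lra.
Qed.

End BoundedMeasurable.

(** * The Markov semigroup on bounded measurable functions *)

Section HeatOperator.
Variable R : realType.
Variables (d : measure_display) (Omega : measurableType d).
Variables (Pr : SU2 R -> probability Omega R) (B : R -> Omega -> SU2 R).
Hypothesis BM : is_brownian Pr B.
Implicit Types (g h : SU2 R) (phi psi : SU2 R -> R) (D : set (SU2 R)) (t s : R).

Local Notation heat := (heat Pr B).

Lemma mass1 g : fine (Pr g [set: Omega]) = 1.
Proof. by have -> : Pr g [set: Omega] = 1%E by exact: probability_setT. Qed.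

Lemma heatE t phi g : heat t phi g = (\int[Pr g]_w phi (B t w))%R.
Proof. by rewrite /Defs.heat unlock. Qed.

Lemma bounded_measurable_integrable t phi g : 0 <= t -> bounded_measurable phi ->
  (Pr g).-integrable setT (EFin \o (fun w => phi (B t w))).
Proof.
move=> t0 [mphi [M phiM]]; apply: measurable_bounded_integrable => //.
- by rewrite [X in (X < _)%E]probability_setT ltry.
- exact: (measurableT_comp mphi (brownian_measurable BM t0)).
- by exists M; split; [exact: num_real|move=> x Mx w _; exact: le_trans (phiM _) (ltW Mx)].
Qed.

Lemma heatD t phi psi g : 0 <= t -> bounded_measurable phi -> bounded_measurable psi ->
  heat t (fun h => phi h + psi h) g = heat t phi g + heat t psi g.
Proof.
by move=> t0 bphi bpsi; rewrite !heatE RintegralD//; exact: bounded_measurable_integrable.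
Qed.

Lemma heatB t phi psi g : 0 <= t -> bounded_measurable phi -> bounded_measurable psi ->
  heat t (fun h => phi h - psi h) g = heat t phi g - heat t psi g.
Proof.
by move=> t0 bphi bpsi; rewrite !heatE RintegralB//; exact: bounded_measurable_integrable.
Qed.

Lemma heatZ t a phi g : 0 <= t -> bounded_measurable phi ->
  heat t (fun h => a * phi h) g = a * heat t phi g.
Proof.
by move=> t0 bphi; rewrite !heatE RintegralZl//; exact: bounded_measurable_integrable.
Qed.

Lemma heat_sum (I : finType) t (a : I -> R) (F : I -> SU2 R -> R) g : 0 <= t ->
  (forall i, bounded_measurable (F i)) ->
  heat t (fun h => \sum_i a i * F i h) g = \sum_i a i * heat t (F i) g.
Proof.
move=> t0 bF.
have [] : bounded_measurable (fun h => \sum_i a i * F i h) /\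
  heat t (fun h => \sum_i a i * F i h) g = \sum_i a i * heat t (F i) g; last by [].
elim: (index_enum I) => [|i s [bs IH]].
  under eq_fun do rewrite big_nil; split.
    by split; [exact: measurable_cst|exists 0 => h; rewrite normr0].
  by rewrite heatE big_nil Rintegral_cst// mul0r.
under eq_fun do rewrite big_cons.
have bZ := bounded_measurableZ (a i) (bF i); split; first exact: bounded_measurableD.
by rewrite heatD// heatZ// IH big_cons.
Qed.

Lemma heat_contraction t phi g (K : R) : 0 <= t -> bounded_measurable phi ->
  (forall h, `|phi h| <= K) -> `|heat t phi g| <= K.
Proof.
move=> t0 bphi phiK; rewrite heatE.
have iphi := bounded_measurable_integrable g t0 bphi.
apply: le_trans (le_normr_Rintegral _ iphi) _ => //.
have -> : K = (\int[Pr g]_(w in setT) K)%R.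
  by rewrite Rintegral_cst// mass1 mulr1.
apply: le_Rintegral => //; last exact: finite_measure_integrable_cst.
by have := integrable_abse iphi.
Qed.

Lemma heat_indic t D g : 0 <= t -> measurable D ->
  heat t \1_D g = fine (Pr g (B t @^-1` D)).
Proof.
move=> t0 mD; rewrite heatE /Rintegral.
have mB : measurable (B t @^-1` D).
  by rewrite -[X in measurable X]setTI; exact: (brownian_measurable BM t0).
have -> : (fun w => (\1_D (B t w))%:E) = (fun w => (\1_(B t @^-1` D) w)%:E : \bar R).
  by apply/funext => w; rewrite !indicE.
by rewrite integral_indic// setIT.
Qed.

(** For indicators this is the measurability of the transition kernel; it extends by
linearity and uniform approximation. *)
Lemma heat_measurable t phi : 0 <= t -> bounded_measurable phi ->
  bounded_measurable (heat t phi).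
Proof.
move=> t0 bphi; split; last first.
  by case: (bphi) => _ [M phiM]; exists M => g; exact: heat_contraction.
have ind D : measurable D -> measurable_fun [set: SU2 R] (heat t \1_D).
  move=> mD; have -> : heat t \1_D = fun g => fine (Pr g (B t @^-1` D)).
    by apply/funext => g; exact: heat_indic.
  exact: (measurableT_comp _ (brownian_kernel BM t0 mD)).
have approx k : exists psi, measurable_fun [set: SU2 R] (heat t psi) /\
    forall g, `|heat t phi g - heat t psi g| <= harmonic k.
  have [n [a [D [mD phiE]]]] := bounded_measurable_simple bphi (harmonic_gt0 k).
  have bD i : bounded_measurable (\1_(D i) : SU2 R -> R) by exact: bounded_measurable_indic.
  have bs := bounded_measurable_sum a bD.
  exists (fun g => \sum_i a i * \1_(D i) g); split; last first.
    move=> g; rewrite -heatB//; apply: heat_contraction => //; exact: bounded_measurableB.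
  have -> : heat t (fun g => \sum_i a i * \1_(D i) g) = fun g => \sum_i a i * heat t \1_(D i) g.
    by apply/funext => g; exact: heat_sum.
  by apply: measurable_sum => i; apply: measurable_funM => //; exact: ind.
have [psi psiP] := choice approx.
apply: (@measurable_fun_cvg _ _ _ _ (fun k => heat t (psi k))).
  by move=> k; have [] := psiP k.
move=> g _; apply/cvgrPdist_le => e e0.
have /cvgrPdist_le/(_ _ e0) := @cvg_harmonic R.
apply: filterS => k; rewrite sub0r normrN ger0_norm ?harmonic_ge0// => ke.
by have [_ /(_ g)] := psiP k; move/le_trans; apply.
Qed.

Lemma heat0 phi g : bounded_measurable phi -> heat 0 phi g = phi g.
Proof.
move=> bphi; rewrite heatE.
have -> : phi g = (\int[Pr g]_(w in setT) phi g)%R.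
  by rewrite Rintegral_cst// mass1 mulr1.
rewrite /Rintegral; congr fine; apply: ae_eq_integral => //.
- by case/integrableP: (bounded_measurable_integrable g (lexx 0) bphi).
- by apply: filterS (brownian_start BM g) => w /= -> .
Qed.

(** The Markov property at time s gives the identity for indicators; linearity and the
contraction property extend it to uniform limits. *)
Lemma heat_semigroup s t phi g : 0 <= s -> 0 <= t -> bounded_measurable phi ->
  heat (s + t) phi g = heat s (heat t phi) g.
Proof.
move=> s0 t0 bphi; have st0 : 0 <= s + t by exact: addr_ge0.
have ind D : measurable D -> heat (s + t) \1_D g = heat s (heat t \1_D) g.
  move=> mD; rewrite heat_indic//.
  have pT : past B s setT.
    rewrite /past; set G := (G in <<s G >>).
    by have := @sigma_algebraCD _ setT G set0 (@sigma_algebra0 _ setT G); rewrite setD0.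
  have := brownian_markov BM g s0 t0 pT mD; rewrite setTI => ->.
  rewrite heatE /Rintegral; congr fine; apply: eq_integral => w _.
  by rewrite heat_indic// fineK// fin_num_measure// -[X in measurable X]setTI;
    exact: (brownian_measurable BM t0).
apply/eqP; rewrite -subr_eq0 -normr_le0; apply/ler_addgt0Pr => e e0; rewrite add0r.
have e2 : 0 < e / 2 by rewrite divr_gt0.
have [n [a [D [mD phiE]]]] := bounded_measurable_simple bphi e2.
have bD i : bounded_measurable (\1_(D i) : SU2 R -> R) by exact: bounded_measurable_indic.
have bs := bounded_measurable_sum a bD.
set psi := fun g => \sum_i a i * \1_(D i) g in bs phiE.
have psiE : heat (s + t) psi g = heat s (heat t psi) g.
  rewrite heat_sum//.
  have -> : heat t psi = fun g => \sum_i a i * heat t \1_(D i) g.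
    by apply/funext => h; exact: heat_sum.
  rewrite heat_sum//; first by apply: eq_bigr => i _; rewrite ind.
  by move=> i; exact: heat_measurable.
have h1 : `|heat (s + t) phi g - heat (s + t) psi g| <= e / 2.
  by rewrite -heatB//; apply: heat_contraction => //; exact: bounded_measurableB.
have h2 : `|heat s (heat t psi) g - heat s (heat t phi) g| <= e / 2.
  have b1 := heat_measurable t0 bs; have b2 := heat_measurable t0 bphi.
  rewrite -heatB//; apply: heat_contraction => //; first exact: bounded_measurableB.
  move=> h; rewrite -heatB//; apply: heat_contraction => //; first exact: bounded_measurableB.
  by move=> k; rewrite distrC.
rewrite -(subrKA (heat (s + t) psi g)) [leRHS]splitr (le_trans (ler_normD _ _))//.
by rewrite lerD// psiE.
Qed.

End HeatOperator.

(** * The Markov semigroup on polynomial functions *)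

Section Identification.
Variable R : realType.
Variables (d : measure_display) (Omega : measurableType d).
Variables (Pr : SU2 R -> probability Omega R) (B : R -> Omega -> SU2 R).
Hypothesis BM : is_brownian Pr B.
Implicit Types (g h : SU2 R) (p : SU2 R -> R) (t s : R) (u : R -> SU2 R -> R).

Local Notation heat := (heat Pr B).
Local Opaque lderive su2X su2Y.

Lemma polyfun_bounded_measurable p : polyfun p -> bounded_measurable p.
Proof. by move=> /polyfun_continuous/bounded_measurable_continuous. Qed.

Lemma generator_small_time p (e : R) : polyfun p -> 0 < e ->
  \forall t \near 0^'+, forall g, `|heat t p g - p g - t * subLaplacian p g| <= e * t.
Proof.
move=> pp e0; have gen := brownian_generator BM (polyfun_Ck 2 pp).
have : \forall t \near 0^'+, forall g,
    `|subLaplacian p g - t^-1 * (heat t p g - p g)| < e.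
  apply: (gen [set k | forall g, `|subLaplacian p g - k g| < e]).
  apply/uniform_nbhs; exists [set xy : R * R | `|xy.1 - xy.2| < e]; split.
    by rewrite -entourage_ballE; exists e.
  by move=> k kP g; exact: kP.
move=> H; near=> t => g; have t0 : 0 < t by [].
have Hg : `|subLaplacian p g - t^-1 * (heat t p g - p g)| < e.
  by move: g; near: t.
have -> : heat t p g - p g - t * subLaplacian p g =
    - (t * (subLaplacian p g - t^-1 * (heat t p g - p g))).
  by move: (subLaplacian p g) (heat t p g) (p g) => *; field; rewrite gt_eqF.
by rewrite normrN normrM gtr0_norm// mulrC ler_pM2r// ltW.
Unshelve. all: by end_near. Qed.

Lemma evolving_subLaplacian u du : evolving_poly u du ->
  evolving_poly (fun t => subLaplacian (u t)) (fun t => subLaplacian (du t)).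
Proof.
case=> I [e [c [dc [pe dcE -> ->]]]].
exists I, (fun i => subLaplacian (e i)), c, dc; split=> //.
- by move=> i; exact: subLaplacian_poly.
- by apply/funext => t; apply/funext => g; exact: (subLaplacian_sum (c^~ t)).
- by apply/funext => t; apply/funext => g; exact: (subLaplacian_sum (dc^~ t)).
Qed.

(** Both sides equal u t + h L u t up to o(h), uniformly in t: on the probabilistic side
because the coefficients of u are bounded and the generator is known on each of
finitely many functions, on the other side because the second time derivative
L L u is bounded. *)
Lemma heat_local_error u (T e : R) : heat_flow u -> 0 < e ->
  \forall h \near 0^'+, forall t g, 0 <= t -> t + h <= T ->
    `|heat h (u t) g - u (t + h) g| <= e * h.
Proof.
move=> hu e0.
have [K K0 LLK] := evolving_bounded (evolving_subLaplacian (evolving_subLaplacian hu)) T.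
have eL := evolving_subLaplacian hu.
case: (hu) => I [el [c [dc [pel dcE uE duE]]]].
have cb i : exists k : R, 0 <= k /\ forall t, 0 <= t <= T -> `|c i t| <= k.
  have ev : evolving_poly (fun t => fun=> c i t) (fun t => fun=> dc i t).
    exists unit, (fun _ => fun=> 1), (fun _ => c i), (fun _ => dc i); split=> //.
    - by move=> _; exact: polyfun_cst.
    - by apply/funext => t; apply/funext => g; rewrite big_const card_unit /= addr0 mulr1.
    - by apply/funext => t; apply/funext => g; rewrite big_const card_unit /= addr0 mulr1.
  have [k k0 H] := evolving_bounded ev T.
  by exists k; split; [exact: ltW|move=> t tT; exact: (H t 1%g tT)].
have [k kP] := choice cb.
pose W := \sum_i k i + 1.
have W0 : 0 < W by rewrite ltr_wpDl// sumr_ge0// => i _; have [] := kP i.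
pose e' := e / 2 / W; have e'0 : 0 < e' by rewrite !divr_gt0.
have gens : \forall h \near 0^'+, forall i g,
    `|heat h (el i) g - el i g - h * subLaplacian (el i) g| <= e' * h.
  by apply: filter_forall => i; exact: generator_small_time.
near=> h; move=> t g t0 th; have h0 : 0 < h by [].
have he : h <= e / 2 / K by near: h; apply: nbhs_right_le; rewrite !divr_gt0.
have tT : 0 <= t <= T by apply/andP; split; lra.
have gh i : `|heat h (el i) g - el i g - h * subLaplacian (el i) g| <= e' * h.
  by move: i g {t0 th tT}; near: h.
have bel i : bounded_measurable (el i) by exact: polyfun_bounded_measurable.
have uth : heat h (u t) g - u t g - h * subLaplacian (u t) g =
    \sum_i c i t * (heat h (el i) g - el i g - h * subLaplacian (el i) g).
  rewrite uE (heat_sum BM (c^~ t) g (ltW h0) bel).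
  rewrite (subLaplacian_sum (c^~ t))// mulr_sumr -!sumrB; apply: eq_bigr => i _.
  by rewrite !mulrBr mulrCA.
have err1 : `|heat h (u t) g - u t g - h * subLaplacian (u t) g| <= e / 2 * h.
  rewrite uth (le_trans (ler_norm_sum _ _ _))//.
  apply: (@le_trans _ _ (\sum_i k i * (e' * h))).
    apply: ler_sum => i _; rewrite normrM; have [k0 kc] := kP i.
    by rewrite ler_pM// kc.
  rewrite -mulr_suml mulrA ler_wpM2r ?(ltW h0)// /e' mulrA ler_pdivrMr// mulrC.
  by rewrite ler_pM2l ?divr_gt0// lerDl.
have err2 : `|u (t + h) g - u t g - h * subLaplacian (u t) g| <= e / 2 * h.
  have tth : t < t + h by rewrite ltrDl.
  have [a /andP[ta at_] ->] := mean_value (evolving_is_derive hu ^~ g) tth.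
  rewrite (_ : t + h - t = h); last by ring.
  rewrite [h * _]mulrC -mulrBl normrM (gtr0_norm h0) ler_wpM2r ?(ltW h0)//.
  have [b /andP[tb ba] ->] := mean_value (evolving_is_derive eL ^~ g) ta.
  have at0 : 0 < a - t by rewrite subr_gt0.
  rewrite normrM (gtr0_norm at0).
  have bT : 0 <= b <= T by apply/andP; split; lra.
  apply: (@le_trans _ _ (K * h)).
    by rewrite ler_pM ?LLK ?(ltW at0)//; lra.
  by rewrite mulrC -ler_pdivlMr.
rewrite (_ : heat h (u t) g - u (t + h) g =
  (heat h (u t) g - u t g - h * subLaplacian (u t) g) -
  (u (t + h) g - u t g - h * subLaplacian (u t) g)); last first.
  by move: (h * _) (heat h (u t) g) => *; ring.
rewrite (le_trans (ler_normB _ _))// (_ : e * h = e / 2 * h + e / 2 * h) ?lerD//.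
by field.
Unshelve. all: by end_near. Qed.

(** Over n steps of length T / n the local errors add up, since the semigroup is a
contraction, to at most n (e / T) (T / n) = e. *)
Lemma heat_of_heat_flow u T g : heat_flow u -> 0 < T -> heat T (u 0) g = u T g.
Proof.
move=> hu T0.
apply/eqP; rewrite -subr_eq0 -normr_le0; apply/ler_addgt0Pr => e e0; rewrite add0r.
have eT : 0 < e / T by rewrite divr_gt0.
have [r /= r0 rP] : exists2 r : R, 0 < r & forall x : R, 0 < x -> x < r ->
    forall t k, 0 <= t -> t + x <= T -> `|heat x (u t) k - u (t + x) k| <= e / T * x.
  have /nbhs_ballP[r r0 rP] := heat_local_error T hu eT.
  exists r => // x x0 xr; apply: rP => //.
  by rewrite /ball /= sub0r normrN gtr0_norm.
pose n := (Num.truncn (T / r)).+1; pose x := T / n%:R.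
have n0 : 0 < n%:R :> R by rewrite ltr0n.
have x0 : 0 < x by rewrite divr_gt0.
have xr : x < r by rewrite ltr_pdivrMr// mulrC -ltr_pdivrMr// truncnS_gt.
have nx : n%:R * x = T by rewrite /x mulrC divfK// gt_eqF.
have bu t : bounded_measurable (u t) by exact: polyfun_bounded_measurable (evolving_polyfun hu t).
have step k : (k <= n)%N -> forall h,
    `|heat (k%:R * x) (u 0) h - u (k%:R * x) h| <= k%:R * (e / T * x).
  elim: k => [_ h|k IH kn h].
    by rewrite !mul0r (heat0 BM)// subrr normr0.
  have {}IH := IH (ltnW kn).
  have kx0 : 0 <= k%:R * x by rewrite mulr_ge0 ?(ltW x0).
  have kxT : k%:R * x + x <= T.
    by rewrite -nx -[X in _ + X <= _]mul1r -mulrDl natr1 ler_wpM2r ?(ltW x0)// ler_nat.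
  have bk := heat_measurable BM kx0 (bu 0).
  have -> : k.+1%:R * x = x + k%:R * x by rewrite -natr1 mulrDl mul1r addrC.
  rewrite (heat_semigroup BM h (ltW x0) kx0 (bu 0)).
  rewrite -(subrKA (heat x (u (k%:R * x)) h)) -natr1 mulrDl mul1r.
  rewrite (le_trans (ler_normD _ _))// lerD//; last by rewrite [x + _]addrC; exact: rP.
  rewrite -(heatB BM h (ltW x0) bk (bu _)).
  by apply: (heat_contraction BM h (ltW x0)) => //; exact: bounded_measurableB.
have := step n (leqnn n) g; rewrite nx => /le_trans; apply.
by rewrite mulrCA nx divfK// gt_eqF.
Qed.

End Identification.

(** * The gradient estimate for the Markov semigroup *)

Section GradientEstimate.
Variable R : realType.
Variables (d : measure_display) (Omega : measurableType d).
Variables (Pr : SU2 R -> probability Omega R) (B : R -> Omega -> SU2 R).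
Hypothesis BM : is_brownian Pr B.
Implicit Types (g h : SU2 R) (p f : SU2 R -> R) (t s : R) (u : R -> SU2 R -> R).

Local Notation heat := (heat Pr B).
Local Notation X := (su2X R).
Local Notation Y := (su2Y R).
Local Opaque lderive su2X su2Y.

(** On polynomial functions the Markov semigroup is the heat flow, whose estimate it inherits. *)
Lemma heat_polyfun p t : polyfun p -> 0 < t -> polyfun (heat t p) /\
  forall M, (forall g, `|p g| <= M) -> forall g,
    hweight t * (lderive X (heat t p) g ^+ 2 + lderive Y (heat t p) g ^+ 2) <= M ^+ 2.
Proof.
move=> pp t0; have [u hu u0] := heat_flow_exists pp.
have -> : heat t p = u t.
  by apply/funext => g; rewrite -u0; exact: heat_of_heat_flow.
split; first exact: (evolving_polyfun hu).
move=> M pM g; have uM k : `|u 0 k| <= M by rewrite u0.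
by have [] := bernstein_estimate hu uM g t0.
Qed.

Lemma hweight_gt0 t : 0 < t -> 0 < hweight t.
Proof. by move=> t0; rewrite subr_gt0 expR_gt1 divr_gt0. Qed.

(** Let p n be polynomial functions within 1 / (n + 1) of f.  The estimate applied to
p n - p m shows that the derivatives of P_t (p n) are uniformly Cauchy, and the bound
passes to the limit. *)
Lemma heat_gradient f t M g : continuous f -> 0 < t -> (forall h, `|f h| <= M) ->
  [/\ lderivable X (heat t f) g, lderivable Y (heat t f) g &
    hweight t * (lderive X (heat t f) g ^+ 2 + lderive Y (heat t f) g ^+ 2) <= M ^+ 2].
Proof.
move=> cf t0 fM; have w0 := hweight_gt0 t0.
have bf := bounded_measurable_continuous cf.
have approx n : exists p, polyfun p /\ forall h, `|f h - p h| < harmonic n.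
  by have [p pp fp] := polyfun_dense cf (harmonic_gt0 n); exists p.
have [p pP] := choice approx.
have pp n : polyfun (p n) by case: (pP n).
have fp n h : `|f h - p n h| <= harmonic n by apply: ltW; case: (pP n).
have bp n := polyfun_bounded_measurable (pp n).
have hp n : polyfun (heat t (p n)) := (heat_polyfun (pp n) t0).1.
pose kappa := (Num.sqrt (hweight t))^-1; have k0 : 0 <= kappa by rewrite invr_ge0 sqrtr_ge0.
have root (x y : R) : 0 <= y -> hweight t * x ^+ 2 <= y ^+ 2 -> `|x| <= kappa * y.
  move=> y0 xy; suff : `|x| ^+ 2 <= (kappa * y) ^+ 2 by rewrite ler_pXn2r// nnegrE mulr_ge0.
  rewrite real_normK ?num_real// exprMn exprVn sqr_sqrtr ?(ltW w0)// mulrC.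
  by rewrite ler_pdivlMr// mulrC.
have diff A : A = X \/ A = Y -> forall n m h,
    `|lderive A (heat t (p n)) h - lderive A (heat t (p m)) h| <=
    kappa * (harmonic n + harmonic m).
  move=> AXY n m h; rewrite -(lderiveB A h (hp n) (hp m)).
  have -> : (fun k => heat t (p n) k - heat t (p m) k) = heat t (fun k => p n k - p m k).
    by apply/funext => k; rewrite (heatB BM k (ltW t0) (bp n) (bp m)).
  have pnm k : `|p n k - p m k| <= harmonic n + harmonic m.
    have -> : p n k - p m k = (f k - p m k) - (f k - p n k) by ring.
    by rewrite (le_trans (ler_normB _ _))// addrC lerD.
  have [_ /(_ _ pnm h) bound] := heat_polyfun (polyfunB (pp n) (pp m)) t0.
  apply: root; first by rewrite addr_ge0 ?harmonic_ge0.
  apply: le_trans bound; rewrite ler_wpM2l ?(ltW w0)//.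
  by case: AXY => ->; rewrite ?lerDl ?lerDr sqr_ge0.
pose K := 1 + kappa.
have lim A : A = X \/ A = Y -> exists l, is_lderive A (heat t f) g l /\
    forall n, `|lderive A (heat t (p n)) g - l| <= K * harmonic n.
  move=> AXY.
  have [||||l [dl ln]] := @is_derive_limit R (fun n s => heat t (p n) (g * su2_exp A s)%g)
    (fun n s => lderive A (heat t (p n)) (g * su2_exp A s)%g)
    (fun s => heat t f (g * su2_exp A s)%g) K 0.
  - by rewrite addr_ge0.
  - by move=> n s; apply: is_derive_flow; exact: polyfun_lderivable.
  - move=> n s; rewrite distrC -(heatB BM _ (ltW t0) bf (bp n)).
    rewrite (@le_trans _ _ (harmonic n))//; last by rewrite ler_peMl ?harmonic_ge0// lerDl.
    by apply: (heat_contraction BM _ (ltW t0)) => //; exact: bounded_measurableB.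
  - move=> n m s; rewrite (le_trans (diff A AXY n m _))// -mulrDr ler_wpM2r ?addr_ge0 ?harmonic_ge0//.
    by rewrite lerDr.
  by exists l; split=> // n; have := ln n; rewrite su2_exp0 mulg1.
have [lX [DX lXn]] := lim X (or_introl erefl).
have [lY [DY lYn]] := lim Y (or_intror erefl).
split; [exact: is_lderive_derivable DX|exact: is_lderive_derivable DY|].
rewrite (is_lderive_val DX) (is_lderive_val DY).
have cvgK (a : R^nat) (l : R) : (forall n, `|a n - l| <= K * harmonic n) -> a @ \oo --> l.
  move=> al; apply/cvgrPdist_le => e e0.
  have : (fun n => K * harmonic n) @ \oo --> K * 0 by apply: cvgMl_tmp; exact: cvg_harmonic.
  rewrite mulr0 => /cvgrPdist_le/(_ _ e0); apply: filterS => n.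
  rewrite sub0r normrN => /(le_trans (ler_norm _)) H.
  by rewrite distrC (le_trans (al n)).
have cX := cvgK _ _ lXn; have cY := cvgK _ _ lYn.
have cF : (fun n => hweight t * (lderive X (heat t (p n)) g * lderive X (heat t (p n)) g +
    lderive Y (heat t (p n)) g * lderive Y (heat t (p n)) g)) @ \oo -->
    hweight t * (lX * lX + lY * lY).
  by apply: cvgMl_tmp; apply: cvgD; apply: cvgM.
have cM : (fun n => M + harmonic n) @ \oo --> M.
  by rewrite -[M in X in _ --> X]addr0; apply: cvgD; [exact: cvg_cst|exact: cvg_harmonic].
rewrite !expr2; apply: (ler_cvg_to cF (cvgM cM cM)).
apply: nearW => n; rewrite /= -!expr2; apply: (heat_polyfun (pp n) t0).2 => h.
rewrite -(subrK (f h) (p n h)) addrC (le_trans (ler_normD _ _))// lerD//.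
by rewrite distrC.
Qed.

End GradientEstimate.

Lemma le_sup_norm (R : realType) (f : SU2 R -> R) g : continuous f -> `|f g| <= sup_norm f.
Proof.
move=> cf; have [M _ fM] := SU2_continuous_bounded cf.
apply: sup_upper_bound; last by exists g.
by split; [exists `|f g|, g|exists M => _ [h _ <-]].
Qed.

Theorem corollary1p3 (R : realType) :
  (forall tf : R, 0 < tf ->
    exists C c : R, 0 < C /\ 0 < c /\
    forall (mu : {measure set (SU2 R) -> \bar R}), is_haar mu ->
    forall (d : measure_display) (Omega : measurableType d)
      (Pr : SU2 R -> probability Omega R) (B : R -> Omega -> SU2 R),
      is_brownian Pr B ->
    forall f : SU2 R -> R, is_Ck 2 f ->
    forall t : R, tf < t ->
      {ae mu, forall g : SU2 R,
        lderivable (su2X R) (heat Pr B t f) g /\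
        lderivable (su2Y R) (heat Pr B t f) g /\
        hgrad_norm (heat Pr B t f) g <= 2 * sup_norm f * (C * expR (- (c * t)))})
  /\
  (forall f : SU2 R -> R, is_Ck 2 f -> SU2_harmonic f ->
    exists a : R, forall g : SU2 R, f g = a).
Proof.
split=> [tf tf0|]; last exact: harmonic_constant.
(* exp (t / 5) - 1 >= q exp (t / 5) for t > tf *)
pose q := 1 - expR (- (tf / 5)).
have q0 : 0 < q by rewrite subr_gt0 expR_lt1 oppr_lt0 divr_gt0.
exists (Num.sqrt q)^-1, 10^-1; split; first by rewrite invr_gt0 sqrtr_gt0.
split; first by rewrite invr_gt0.
move=> mu _ d Omega Pr B BM f f2 t tft; apply: aeW => g.
have t0 : 0 < t by exact: lt_trans tft.
have cf : continuous f by case: f2.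
have fM h : `|f h| <= sup_norm f by exact: le_sup_norm.
have M0 : 0 <= sup_norm f by exact: le_trans (fM g).
have [dX dY] := heat_gradient BM g cf t0 fM.
set S := _ + _ => bound; split=> //; split=> //; rewrite /hgrad_norm -/S.
set M := sup_norm f in M0 bound *.
have wq : expR (t / 5) * q <= hweight t.
  rewrite /q /hweight mulrBr mulr1 -expRD lerD2l lerN2 -[leLHS]expR0 ler_expR.
  by rewrite -mulrBl divr_ge0// subr_ge0 ltW.
have w0 : 0 < expR (t / 5) * q by rewrite mulr_gt0 ?expR_gt0.
have S0 : 0 <= S by rewrite addr_ge0 ?sqr_ge0.
have SM : S <= M ^+ 2 / (expR (t / 5) * q).
  by rewrite ler_pdivlMr// mulrC (le_trans _ bound)// ler_wpM2r.
apply: (@le_trans _ _ (M * ((Num.sqrt q)^-1 * expR (- (10^-1 * t))))); last first.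
  by rewrite -mulrA ler_peMl ?ler1n// !mulr_ge0 ?expR_ge0 ?invr_ge0 ?sqrtr_ge0.
rewrite -[leRHS]ger0_norm ?mulr_ge0 ?expR_ge0 ?invr_ge0 ?sqrtr_ge0// -sqrtr_sqr ler_sqrt ?sqr_ge0//.
have expE : expR (- (10^-1 * t)) ^+ 2 = (expR (t / 5))^-1.
  by rewrite expr2 -expRD -expRN; congr expR; field.
by rewrite (le_trans SM)// !exprMn exprVn sqr_sqrtr ?(ltW q0)// expE invfM [q^-1 * _]mulrC.
Qed.
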